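(* Let $k,m\in\mathbb{N}$ with $1\le m\le k$, let $c,d>-1$, and let $\alpha(\cdot)$ be a real-valued function on $(1,\infty)$ with $k-1<\alpha(y)<k$ for all $y$. For $y>1$ and integers $j\ge 0$, $n\ge 0$, write $\frac{d^n}{dy^n}\breve R_j^{c,d,\alpha(y)}(y)$ for the $n$-th derivative with the order frozen at $\alpha(y)$, as defined in the context. Then for every $y>1$, $$\frac{d^m}{dy^m}\breve R_0^{c,d,\alpha(y)}(y)=\frac{(y+1)^{k-\alpha(y)-m}-(y-1)^{k-\alpha(y)-m}}{\Gamma(k-\alpha(y)+1-m)},$$ $$\begin{aligned}\frac{d^m}{dy^m}\breve R_1^{c,d,\alpha(y)}(y)={}&\frac{P_1^{c,d}(-1)(y+1)^{k-\alpha(y)-m}-P_1^{c,d}(1)(y-1)^{k-\alpha(y)-m}}{\Gamma(k-\alpha(y)+1-m)}\\&+\frac{(c+d+2)\left((y+1)^{k-\alpha(y)+1-m}-(y-1)^{k-\alpha(y)+1-m}\right)}{2\,\Gamma(k-\alpha(y)+2-m)},\end{aligned}$$ and for every $j\ge 1$, $$\begin{aligned}\frac{d^m}{dy^m}\breve R_{j+1}^{c,d,\alpha(y)}(y)={}&\left(\widetilde A_j^{c,d,\alpha(y)}y-\widetilde B_j^{c,d,\alpha(y)}\right)\frac{d^m}{dy^m}\breve R_j^{c,d,\alpha(y)}(y)-\widetilde C_j^{c,d,\alpha(y)}\frac{d^m}{dy^m}\breve R_{j-1}^{c,d,\alpha(y)}(y)\\&+m\,\widetilde A_j^{c,d,\alpha(y)}\frac{d^{m-1}}{dy^{m-1}}\breve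 R_j^{c,d,\alpha(y)}(y)\\&+\frac{\widetilde D_j^{c,d,\alpha(y)}(y+1)^{k-\alpha(y)-m}-\widetilde E_j^{c,d,\alpha(y)}(y-1)^{k-\alpha(y)-m}}{(k-\alpha(y))^{-1}\,\Gamma(k-\alpha(y)+1-m)}.\end{aligned}$$
   Context: $P_j^{c,d}$ denotes the Jacobi polynomial of degree $j$ with parameters $c,d>-1$, with the standard normalization $P_j^{c,d}(1)=\frac{\Gamma(j+c+1)}{j!\,\Gamma(c+1)}$ (orthogonal on $(-1,1)$ with weight $(1-s)^c(1+s)^d$). For a constant $\beta\in(k-1,k)$ and $z>1$, put $$\breve R_j^{c,d,\beta}(z)=\frac{1}{\Gamma(k-\beta)}\int_{-1}^1\frac{P_j^{c,d}(s)}{(z-s)^{\beta-k+1}}\,ds .$$ The notation $\frac{d^n}{dy^n}\breve R_j^{c,d,\alpha(y)}(y)$ means: set $\beta=\alpha(y)$ (a fixed number), differentiate $z\mapsto \breve R_j^{c,d,\beta}(z)$ $n$ times in $z$, and evaluate at $z=y$ (for $n=0$ it is $\breve R_j^{c,d,\alpha(y)}(y)$ itself). This matches the definition of the variable-order Riemann–Liouville derivative, in which the order is held at $\alpha(y)$ during differentiation. Coefficients, for $j\ge1$. Three-term recurrence coefficients, so that $P_{j+1}^{c,d}(s)=(A_j^{c,d}s-B_j^{c,d})P_j^{c,d}(s)-C_j^{c,d}P_{j-1}^{c,d}(s)$: $$A_j^{c,d}=\frac{(2j+c+d+1)(2j+c+d+2)}{2(j+1)(j+c+d+1)},\quad B_j^{c,d}=\frac{(d^2-c^2)(2j+c+d+1)}{2(j+1)(j+c+d+1)(2j+c+d)},$$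 $$C_j^{c,d}=\frac{(j+c)(j+d)(2j+c+d+2)}{(j+1)(j+c+d+1)(2j+c+d)}.$$ Derivative-relation coefficients, so that $P_j^{c,d}=\widehat A_j^{c,d}\frac{d}{ds}P_{j-1}^{c,d}+\widehat B_j^{c,d}\frac{d}{ds}P_j^{c,d}+\widehat C_j^{c,d}\frac{d}{ds}P_{j+1}^{c,d}$: $$\widehat A_j^{c,d}=\frac{-2(j+c)(j+d)}{(j+c+d)(2j+c+d)(2j+c+d+1)},\quad \widehat B_j^{c,d}=\frac{2(c-d)}{(2j+c+d)(2j+c+d+2)},$$ $$\widehat C_j^{c,d}=\frac{2(j+c+d+1)}{(2j+c+d+1)(2j+c+d+2)},$$ with the convention $\widehat A_1^{c,d}=0$ when $c+d=-1$. Finally, with $\mu=k-\alpha(y)$, $$\widetilde A_j^{c,d,\alpha(y)}=\frac{A_j^{c,d}}{1+\mu A_j^{c,d}\widehat C_j^{c,d}},\quad \widetilde B_j^{c,d,\alpha(y)}=\frac{B_j^{c,d}+\mu A_j^{c,d}\widehat B_j^{c,d}}{1+\mu A_j^{c,d}\widehat C_j^{c,d}},\quad \widetilde C_j^{c,d,\alpha(y)}=\frac{C_j^{c,d}+\mu A_j^{c,d}\widehat A_j^{c,d}}{1+\mu A_j^{c,d}\widehat C_j^{c,d}},$$ $$\widetilde D_j^{c,d,\alpha(y)}=\frac{A_j^{c,d}\left(\widehat A_j^{c,d}P_{j-1}^{c,d}(-1)+\widehat B_j^{c,d}P_j^{c,d}(-1)+\widehat C_j^{c,d}P_{j+1}^{c,d}(-1)\right)}{1+\mu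 A_j^{c,d}\widehat C_j^{c,d}},$$ $$\widetilde E_j^{c,d,\alpha(y)}=\frac{A_j^{c,d}\left(\widehat A_j^{c,d}P_{j-1}^{c,d}(1)+\widehat B_j^{c,d}P_j^{c,d}(1)+\widehat C_j^{c,d}P_{j+1}^{c,d}(1)\right)}{1+\mu A_j^{c,d}\widehat C_j^{c,d}}.$$ *)

(* Defs.v *)
From Stdlib Require Import Reals Factorial.
From Coquelicot Require Import Coquelicot.
Open Scope R_scope.

(* Euler's integral of the second kind; meaningful for x > 0. *)
Definition Gamma_euler (x : R) : R :=
  RInt_gen (fun t => Rpower t (x - 1) * exp (- t))
           (at_right 0) (Rbar_locally p_infty).

(* x (x + 1) ... (x + n - 1) *)
Fixpoint rising (x : R) (n : nat) : R :=
  match n with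
  | O => 1
  | S n' => rising x n' * (x + INR n')
  end.

(* Gamma on R minus {0, -1, -2, ...}, continued to negative arguments by
   Gamma x = Gamma (x + n) / (x (x + 1) ... (x + n - 1)).  Here [up r] is the
   integer in (r, r + 1], so x + n > 0, and n = 0 whenever x > 0. *)
Definition Gamma (x : R) : R :=
  let n := Z.to_nat (up (- x)) in
  Gamma_euler (x + INR n) / rising x n.

Definition is_poly_of_degree (n : nat) (p : R -> R) : Prop :=
  exists a : nat -> R,
    a n <> 0 /\ forall s, p s = sum_f_R0 (fun i => a i * s ^ i) n.

(* P j is the Jacobi polynomial of degree j.  The orthogonality integrals are
   improper at both ends, since the weight is unbounded near 1 (resp. -1) when
   c < 0 (resp. d < 0); [is_RInt_gen] includes their convergence. *)
Record is_jacobi (c d : R) (P : nat -> R -> R) : Prop := {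
  jacobi_degree : forall j, is_poly_of_degree j (P j);
  jacobi_orthogonal : forall i j, i <> j ->
    is_RInt_gen (fun s => P i s * P j s * (Rpower (1 - s) c * Rpower (1 + s) d))
                (at_right (-1)) (at_left 1) 0;
  jacobi_at_1 : forall j,
    P j 1 = Gamma (INR j + c + 1) / (INR (fact j) * Gamma (c + 1))
}.

Definition breveR (k : nat) (P : nat -> R -> R) (beta : R) (j : nat) (z : R) : R :=
  / Gamma (INR k - beta) *
  RInt (fun s => P j s / Rpower (z - s) (beta - INR k + 1)) (-1) 1.

(* The order is frozen at alpha y while differentiating. *)
Definition frozen_derive (k : nat) (P : nat -> R -> R) (alpha : R -> R)
    (j n : nat) (y : R) : R :=
  Derive_n (breveR k P (alpha y) j) n y.

(* The coefficients below are used for j >= 1 only. *)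

Definition recA (c d : R) (j : nat) : R :=
  let j := INR j in
  (2 * j + c + d + 1) * (2 * j + c + d + 2) / (2 * (j + 1) * (j + c + d + 1)).

Definition recB (c d : R) (j : nat) : R :=
  let j := INR j in
  (d ^ 2 - c ^ 2) * (2 * j + c + d + 1) /
  (2 * (j + 1) * (j + c + d + 1) * (2 * j + c + d)).

Definition recC (c d : R) (j : nat) : R :=
  let j := INR j in
  (j + c) * (j + d) * (2 * j + c + d + 2) /
  ((j + 1) * (j + c + d + 1) * (2 * j + c + d)).

(* For c, d > -1 and j >= 1, j + c + d = 0 happens only when j = 1 and
   c + d = -1, where the coefficient is 0 by convention. *)
Definition hatA (c d : R) (j : nat) : R :=
  let j := INR j in
  if Req_EM_T (j + c + d) 0 then 0
  else - 2 * (j + c) * (j + d) /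
       ((j + c + d) * (2 * j + c + d) * (2 * j + c + d + 1)).

Definition hatB (c d : R) (j : nat) : R :=
  let j := INR j in
  2 * (c - d) / ((2 * j + c + d) * (2 * j + c + d + 2)).

Definition hatC (c d : R) (j : nat) : R :=
  let j := INR j in
  2 * (j + c + d + 1) / ((2 * j + c + d + 1) * (2 * j + c + d + 2)).

(* In the modified coefficients, mu stands for k - alpha y. *)

Definition tildeDen (c d mu : R) (j : nat) : R :=
  1 + mu * recA c d j * hatC c d j.

Definition tildeA (c d mu : R) (j : nat) : R :=
  recA c d j / tildeDen c d mu j.

Definition tildeB (c d mu : R) (j : nat) : R :=
  (recB c d j + mu * recA c d j * hatB c d j) / tildeDen c d mu j.

Definition tildeC (c d mu : R) (j : nat) : R :=
  (recC c d j + mu * recA c d j * hatA c d j) / tildeDen c d mu j.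

Definition hatSum (c d : R) (P : nat -> R -> R) (j : nat) (s : R) : R :=
  hatA c d j * P (j - 1)%nat s + hatB c d j * P j s + hatC c d j * P (j + 1)%nat s.

Definition tildeD (c d : R) (P : nat -> R -> R) (mu : R) (j : nat) : R :=
  recA c d j * hatSum c d P j (-1) / tildeDen c d mu j.

Definition tildeE (c d : R) (P : nat -> R -> R) (mu : R) (j : nat) : R :=
  recA c d j * hatSum c d P j 1 / tildeDen c d mu j.

(* Main.v *)
Require Import Defs.
From Stdlib Require Import Reals ZArith Lra Lia.
From Coquelicot Require Import Coquelicot.
Open Scope R_scope.

(**
The recurrence comes from two facts about Jacobi polynomials and one integration by
parts.  Put [mu = k - alpha y], so that [0 < mu < 1] and [breveR j z] is
[/ Gamma mu] times the integral of [P_j s * (z - s)^(mu - 1)].  Inserting the three-term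
recurrence for [P_(j+1)] and writing [s = z - (z - s)] leaves one integral of another
shape, that of [P_j s * (z - s)^mu].  Since [P_j] is the derivative of
[hatSum_j = hatA P_(j-1) + hatB P_j + hatC P_(j+1)], an integration by parts turns this
integral into boundary terms plus [mu] times the integrals for [j - 1], [j] and [j + 1].
Solving for the integral at [j + 1], i.e. dividing by [tildeDen > 0], gives the recurrence
before differentiation ([kernel_int_jac_recurrence]).  The starting values [j = 0, 1] follow
from the same integration by parts, and [m] differentiations with the order frozen give
the theorem: Leibniz' rule on [a * z - b] produces the term with the factor [m], and
[Gamma (p + 1) = p (p - 1) ... (p - m + 1) Gamma (p + 1 - m)] absorbs the constants
coming from the powers.  Smoothness on [z > 1] is propagated by the recurrence from
[j = 0, 1], where the integrals are explicit powers, to all [j].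

What has to be supplied is the theory behind these steps.

Jacobi polynomials are characterised by degree, orthogonality and the value at 1, and
the three-term and derivative relations must be deduced from that.  The family [jac] is
defined by the three-term recurrence.  By induction it satisfies the two ladder relations
expressing [(1 - s^2) jac_n'] through neighbours ([ladder]); these give the value at 1,
the Jacobi differential equation ([jacobi_ode]) and the derivative relation
([jac_eq_derivatives]).  The differential equation is of Sturm-Liouville form, hence
[jac] is orthogonal ([jac_orthogonal]); and a family with the three characterising
properties is unique on [[-1, 1]] ([jacobi_unique]), so [P] and [jac] agree there.

Orthogonality is handled as the statement that certain improper integrals converge to 0.
All those used are linear combinations of the given ones and of integrals of exact
derivatives, for which convergence comes with the boundary values.

For the Gamma function the proof needs [Gamma (x + 1) = x Gamma x] for [x <> 0] and
positivity for [x > 0], both obtained from the convergence of Euler's integral.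
*)

(** * Improper integrals and the Gamma function *)

Lemma is_derive_Rpower (p x : R) :
  0 < x -> is_derive (fun t => Rpower t p) x (p * Rpower x (p - 1)).
Proof. intros hx; apply is_derive_Reals; now apply derivable_pt_lim_power. Qed.

Lemma continuous_Rpower (p x : R) : 0 < x -> continuous (fun t => Rpower t p) x.
Proof.
  intros hx; apply (ex_derive_continuous (fun t => Rpower t p)).
  eexists; now apply is_derive_Rpower.
Qed.

Lemma Rpower_pos (x p : R) : 0 < Rpower x p.
Proof. apply exp_pos. Qed.

Lemma Rpower_plus_1 (x p : R) : 0 < x -> Rpower x (p + 1) = x * Rpower x p.
Proof. intros hx; rewrite Rpower_plus, Rpower_1 by lra; ring. Qed.

Lemma filterlim_Rpower_0 (p : R) :
  0 < p -> filterlim (fun t => Rpower t p) (at_right 0) (locally 0).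
Proof.
  intros hp; unfold Rpower.
  apply (filterlim_comp _ _ _ (fun t => p * ln t) exp _ (Rbar_locally m_infty)).
  - apply (filterlim_comp _ _ _ ln (fun u => p * u) _ (Rbar_locally m_infty)).
    + apply is_lim_ln_0.
    + intros P [M HM]; exists (M / p); intros u hu; apply HM.
      apply (Rmult_lt_compat_l p) in hu; [|lra].
      replace (p * (M / p)) with M in hu by (field; lra); lra.
  - apply is_lim_exp_m.
Qed.

(** Unlike [is_RInt_gen_Derive], the integrand is given explicitly, which avoids
rewriting [Derive F] under the integral. *)
Lemma is_RInt_gen_antiderivative (Fa Fb : (R -> Prop) -> Prop)
  {FFa : Filter Fa} {FFb : Filter Fb} (F f : R -> R) (la lb : R) :
  filter_prod Fa Fb (fun uv => forall x, Rmin (fst uv) (snd uv) <= x <= Rmax (fst uv) (snd uv) ->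
    is_derive F x (f x) /\ continuous f x) ->
  filterlim F Fa (locally la) -> filterlim F Fb (locally lb) ->
  is_RInt_gen f Fa Fb (lb - la).
Proof.
  intros hF ha hb.
  apply (filterlimi_lim_ext_loc (fun uv => F (snd uv) - F (fst uv))).
  - revert hF; apply filter_imp; intros [u v] h; simpl in *.
    apply (is_RInt_derive (V := R_CompleteNormedModule) F f); intros x hx; now apply h.
  - apply (filterlim_comp_2 (G := locally lb) (H := locally (- la))
             (fun uv => F (snd uv)) (fun uv => - F (fst uv)) Rplus);
      [| |apply (filterlim_plus (V := R_NormedModule))].
    + eapply filterlim_comp; [apply filterlim_snd|exact hb].
    + apply (filterlim_comp _ _ _ (fun uv => F (fst uv)) Ropp _ (locally la));
        [|apply (filterlim_opp (V := R_NormedModule))].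
      eapply filterlim_comp; [apply filterlim_fst|exact ha].
Qed.

Lemma ball_R (x e y : R) : ball x e y <-> x - e < y < x + e.
Proof.
  change (Rabs (y - x) < e <-> x - e < y < x + e); split; intros h.
  - apply Rabs_def2 in h; lra.
  - apply Rabs_def1; lra.
Qed.

Lemma filter_prod_pos_half_line (P : R * R -> Prop) (a b : R) :
  0 < a -> (forall u v, 0 < u < a -> b < v -> P (u, v)) ->
  filter_prod (at_right 0) (Rbar_locally p_infty) P.
Proof.
  intros ha hP.
  apply (Filter_prod _ _ _ (fun u => 0 < u < a) (fun v => b < v)); auto.
  - exists (mkposreal a ha); intros x hx hx0.
    apply ball_R in hx; simpl in hx; lra.
  - exists b; auto.
Qed.

Lemma RInt_widen (f : R -> R) (u a b v : R) :
  u <= a <= b -> b <= v -> (forall x, u <= x <= v -> continuous f x /\ 0 <= f x) ->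
  RInt f a b <= RInt f u v.
Proof.
  intros hua hbv hf.
  assert (hint : forall p q, u <= p -> p <= q -> q <= v -> ex_RInt f p q).
  { intros p q hp hpq hq; apply (ex_RInt_continuous (V := R_CompleteNormedModule)).
    rewrite Rmin_left, Rmax_right by lra; intros x hx; apply hf; lra. }
  assert (hpos : forall p q, u <= p -> p <= q -> q <= v -> 0 <= RInt f p q).
  { intros p q hp hpq hq; apply RInt_ge_0; [lra|now apply hint|].
    intros x hx; apply hf; lra. }
  rewrite <- (RInt_Chasles f u a v), <- (RInt_Chasles f a b v) by (apply hint; lra).
  unfold plus; simpl.
  assert (p1 := hpos u a ltac:(lra) ltac:(lra) ltac:(lra)).
  assert (p2 := hpos b v ltac:(lra) ltac:(lra) ltac:(lra)).
  lra.
Qed.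

(** Lower bounds for improper integrals of nonnegative functions; through
[RInt_gen_gt_0] this gives both the positivity of Euler's integral and the
definiteness of the weighted scalar product. *)
Lemma RInt_le_RInt_gen (Fa Fb : (R -> Prop) -> Prop)
  {FFa : ProperFilter Fa} {FFb : ProperFilter Fb} (f : R -> R) (a b l : R) :
  a <= b ->
  filter_prod Fa Fb (fun uv => fst uv <= a /\ b <= snd uv /\
    forall x, fst uv <= x <= snd uv -> continuous f x /\ 0 <= f x) ->
  is_RInt_gen f Fa Fb l -> RInt f a b <= l.
Proof.
  intros hab hF hl.
  destruct (Rle_or_lt (RInt f a b) l) as [h|h]; [exact h|exfalso].
  assert (he : 0 < RInt f a b - l) by lra.
  assert (hl' := proj1 (filterlimi_locally _ _) hl (mkposreal _ he)).
  assert (FF := filter_prod_proper (F := Fa) (G := Fb)).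
  destruct (filter_ex _ (filter_and _ _ hF hl')) as [[u v] [[hu [hv hf]] [I [hI hb]]]].
  simpl in *.
  assert (h1 := RInt_widen f u a b v ltac:(lra) hv hf).
  rewrite <- (is_RInt_unique _ _ _ _ hI) in hb.
  apply ball_R in hb; simpl in hb; lra.
Qed.

Lemma RInt_gen_gt_0 (Fa Fb : (R -> Prop) -> Prop)
  {FFa : ProperFilter Fa} {FFb : ProperFilter Fb} (f : R -> R) (a b l : R) :
  a < b -> (forall x, a <= x <= b -> 0 < f x) ->
  filter_prod Fa Fb (fun uv => fst uv <= a /\ b <= snd uv /\
    forall x, fst uv <= x <= snd uv -> continuous f x /\ 0 <= f x) ->
  is_RInt_gen f Fa Fb l -> 0 < l.
Proof.
  intros hab hpos hF hl.
  apply Rlt_le_trans with (RInt f a b).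
  - assert (FF := filter_prod_proper (F := Fa) (G := Fb)).
    destruct (filter_ex _ hF) as [[u v] [hu [hv hf]]]; simpl in *.
    apply RInt_gt_0; [lra|intros x hx; apply hpos; lra|intros x hx; apply hf; lra].
  - apply (RInt_le_RInt_gen Fa Fb); auto; lra.
Qed.

(** The integrals over compact subintervals increase with the subinterval, so they
converge to their supremum. *)
Lemma ex_RInt_gen_bounded (f : R -> R) (M : R) :
  (forall x, 0 < x -> continuous f x /\ 0 <= f x) ->
  (forall u v, 0 < u -> u <= v -> RInt f u v <= M) ->
  exists l, is_RInt_gen f (at_right 0) (Rbar_locally p_infty) l.
Proof.
  intros hf hM.
  destruct (completeness (fun r => exists u v, 0 < u <= v /\ r = RInt f u v)) as [l [hub hlub]].
  - exists M; intros r (u & v & [hu huv] & ->); now apply hM.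
  - exists (RInt f 1 1), 1, 1; split; [lra|reflexivity].
  - exists l.
    apply (filterlimi_lim_ext_loc (fun uv => RInt f (fst uv) (snd uv))).
    + apply (filter_prod_pos_half_line _ 1 1); [lra|].
      intros u v hu hv; simpl; apply (RInt_correct (V := R_CompleteNormedModule)).
      apply (ex_RInt_continuous (V := R_CompleteNormedModule)).
      rewrite Rmin_left by lra; intros x hx; apply hf; lra.
    + apply filterlim_locally; intros eps.
      destruct (Classical_Prop.classic (exists u v, 0 < u <= v /\ l - eps < RInt f u v))
        as [(a & b & hab & hI)|hno].
      2:{ exfalso; assert (hle : l <= l - eps).
          { apply hlub; intros r (u & v & huv & ->).
            destruct (Rle_or_lt (RInt f u v) (l - eps)) as [h|h]; [exact h|].
            exfalso; apply hno; now exists u, v. }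
          assert (h := cond_pos eps); lra. }
      apply (filter_prod_pos_half_line _ a b); [lra|].
      intros u v hu hv; simpl.
      assert (h1 := RInt_widen f u a b v ltac:(lra) ltac:(lra) ltac:(intros; apply hf; lra)).
      assert (h3 : RInt f u v <= l) by (apply hub; exists u, v; split; [lra|reflexivity]).
      apply ball_R; lra.
Qed.

(** Any power is dominated by [exp (t / 2)], which controls Euler's integrand at
infinity.  The bound is [ln u <= u - 1] at [u = t / (2 q)], multiplied by some [q > 0]
with [p <= q]. *)
Lemma Rpower_le_exp (p : R) :
  exists C, forall t, 1 <= t -> Rpower t p <= C * exp (t / 2).
Proof.
  set (q := Rabs p + 1).
  assert (hq : 0 < q) by (unfold q; assert (h := Rabs_pos p); lra).
  exists (exp (q * ln (2 * q))); intros t ht.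
  rewrite <- exp_plus; unfold Rpower.
  assert (hln : ln t <= t / (2 * q) + ln (2 * q)).
  { replace (ln t) with (ln (t / (2 * q)) + ln (2 * q)).
    - assert (hp : 0 < t / (2 * q)) by (apply Rdiv_lt_0_compat; lra).
      assert (h := exp_ineq1_le (ln (t / (2 * q)))); rewrite exp_ln in h by lra; lra.
    - rewrite <- ln_mult; [f_equal; field; lra|apply Rdiv_lt_0_compat; lra|lra]. }
  assert (h0 : 0 <= ln t) by (rewrite <- ln_1; apply Rcomplements.ln_le; lra).
  assert (hpq : p * ln t <= q * ln t).
  { apply Rmult_le_compat_r; [lra|]; unfold q; assert (h := Rle_abs p); lra. }
  assert (hqq : q * ln t <= q * ln (2 * q) + t / 2).
  { apply Rle_trans with (q * (t / (2 * q) + ln (2 * q))).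
    - apply Rmult_le_compat_l; lra.
    - right; field; lra. }
  destruct (Rle_lt_or_eq_dec _ _ (Rle_trans _ _ _ hpq hqq)) as [h| ->];
    [left; now apply exp_increasing|right; reflexivity].
Qed.

Lemma is_derive_exp_opp (t : R) : is_derive (fun t => exp (- t)) t (- exp (- t)).
Proof. auto_derive; [easy|ring]. Qed.

Lemma continuous_euler_integrand (p t : R) :
  0 < t -> continuous (fun t => Rpower t p * exp (- t)) t.
Proof.
  intros ht; apply (continuous_mult (fun t => Rpower t p) (fun t => exp (- t))).
  - now apply continuous_Rpower.
  - apply (ex_derive_continuous (fun t => exp (- t))); eexists; apply is_derive_exp_opp.
Qed.

(** Near 0 the integrand lies below [t^(x - 1)], whose integral over [(0, 1)] is [1 / x];
on [[1, oo)] it lies below a multiple of [exp (- t / 2)]. *)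
Lemma Gamma_euler_converges (x : R) :
  0 < x ->
  is_RInt_gen (fun t => Rpower t (x - 1) * exp (- t)) (at_right 0) (Rbar_locally p_infty)
    (Gamma_euler x).
Proof.
  intros hx.
  set (f := fun t => Rpower t (x - 1) * exp (- t)).
  assert (hf : forall t, 0 < t -> continuous f t /\ 0 <= f t).
  { intros t ht; split; [now apply continuous_euler_integrand|].
    unfold f; apply Rmult_le_pos; left; [apply Rpower_pos|apply exp_pos]. }
  assert (hint : forall p q, 0 < p -> p <= q -> ex_RInt f p q).
  { intros p q hp hpq; apply (ex_RInt_continuous (V := R_CompleteNormedModule)).
    rewrite Rmin_left by lra; intros t ht; apply hf; lra. }
  destruct (Rpower_le_exp (x - 1)) as [C hC].
  assert (hC0 : 0 <= C).
  { assert (h := hC 1 ltac:(lra)); assert (h1 := Rpower_pos 1 (x - 1)).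
    assert (h2 := exp_pos (1 / 2)).
    destruct (Rle_or_lt 0 C) as [h3|h3]; [exact h3|].
    assert (C * exp (1 / 2) < 0) by (rewrite <- (Rmult_0_l (exp (1 / 2))); now apply Rmult_lt_compat_r).
    lra. }
  assert (hI0 : forall u, 0 < u <= 1 -> RInt f u 1 <= / x).
  { intros u hu.
    assert (hD : is_RInt (fun t => Rpower t (x - 1)) u 1 (minus (/ x * Rpower 1 x) (/ x * Rpower u x))).
    { apply (is_RInt_derive (fun t => / x * Rpower t x)); rewrite Rmin_left, Rmax_right by lra.
      - intros t ht; evar_last.
        + apply is_derive_scal, is_derive_Rpower; lra.
        + simpl; field; lra.
      - intros t ht; apply continuous_Rpower; lra. }
    apply Rle_trans with (RInt (fun t => Rpower t (x - 1)) u 1).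
    - apply RInt_le; [lra|apply hint; lra|eexists; exact hD|].
      intros t ht; unfold f; rewrite <- (Rmult_1_r (Rpower t (x - 1))) at 2.
      apply Rmult_le_compat_l; [left; apply Rpower_pos|].
      rewrite <- exp_0; left; apply exp_increasing; lra.
    - rewrite (is_RInt_unique _ _ _ _ hD).
      replace (Rpower 1 x) with 1 by (unfold Rpower; rewrite ln_1, Rmult_0_r, exp_0; reflexivity).
      unfold minus, plus, opp; simpl.
      assert (0 < / x * Rpower u x) by (apply Rmult_lt_0_compat; [now apply Rinv_0_lt_compat|apply Rpower_pos]).
      lra. }
  assert (hI1 : forall v, 1 <= v -> RInt f 1 v <= 2 * C).
  { intros v hv.
    assert (hD : is_RInt (fun t => C * exp (- t / 2)) 1 v (minus (- 2 * C * exp (- v / 2)) (- 2 * C * exp (- 1 / 2)))).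
    { apply (is_RInt_derive (fun t => - 2 * C * exp (- t / 2))).
      - intros t ht; auto_derive; [easy|]; unfold Rdiv; field.
      - intros t ht; apply (ex_derive_continuous (fun t => C * exp (- t / 2))).
        auto_derive; easy. }
    apply Rle_trans with (RInt (fun t => C * exp (- t / 2)) 1 v).
    - apply RInt_le; [lra|apply hint; lra|eexists; exact hD|].
      intros t ht; unfold f.
      apply Rle_trans with (C * exp (t / 2) * exp (- t)).
      + apply Rmult_le_compat_r; [left; apply exp_pos|apply hC; lra].
      + right; rewrite Rmult_assoc, <- exp_plus; do 2 f_equal; field.
    - rewrite (is_RInt_unique _ _ _ _ hD); unfold minus, plus, opp; simpl.
      assert (h1 : 0 < exp (- v / 2)) by apply exp_pos.
      assert (h2 : exp (- 1 / 2) < 1) by (rewrite <- exp_0; apply exp_increasing; lra).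
      nra. }
  destruct (ex_RInt_gen_bounded f (/ x + 2 * C)) as [l hl]; [exact hf| |].
  - intros u v hu huv.
    assert (hx0 : 0 < / x) by now apply Rinv_0_lt_compat.
    set (u' := Rmin u 1); set (v' := Rmax v 1).
    assert (hu' : 0 < u' <= 1 /\ u' <= u).
    { unfold u', Rmin; destruct (Rle_dec u 1); lra. }
    assert (hv' : 1 <= v' /\ v <= v').
    { unfold v', Rmax; destruct (Rle_dec v 1); lra. }
    assert (h1 := RInt_widen f u' u v v' ltac:(lra) ltac:(lra) ltac:(intros; apply hf; lra)).
    assert (h3 := RInt_Chasles f u' 1 v' (hint u' 1 ltac:(lra) ltac:(lra)) (hint 1 v' ltac:(lra) ltac:(lra))).
    assert (q1 := hI0 u' ltac:(lra)); assert (q2 := hI1 v' ltac:(lra)).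
    unfold plus in h3; simpl in h3; lra.
  - unfold Gamma_euler; fold f.
    rewrite (is_RInt_gen_unique f l hl); exact hl.
Qed.

Lemma Gamma_euler_pos (x : R) : 0 < x -> 0 < Gamma_euler x.
Proof.
  intros hx.
  refine (RInt_gen_gt_0 (at_right 0) (Rbar_locally p_infty) _ 1 2 _ ltac:(lra) _ _
            (Gamma_euler_converges x hx)).
  - intros t ht; apply Rmult_lt_0_compat; [apply Rpower_pos|apply exp_pos].
  - apply (filter_prod_pos_half_line _ 1 2); [lra|]; intros u v hu hv; simpl.
    split; [lra|split; [lra|]]; intros t ht; split.
    + apply continuous_euler_integrand; lra.
    + apply Rmult_le_pos; left; [apply Rpower_pos|apply exp_pos].
Qed.

(** Integration by parts: [t^x exp (-t)] vanishes at both ends, so the integral of its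
derivative [x t^(x-1) exp (-t) - t^x exp (-t)] is 0. *)
Lemma Gamma_euler_plus_1 (x : R) : 0 < x -> Gamma_euler (x + 1) = x * Gamma_euler x.
Proof.
  intros hx.
  set (F := fun t => Rpower t x * exp (- t)).
  assert (h0 : filterlim F (at_right 0) (locally 0)).
  { replace 0 with (mult 0 (exp (- 0))) at 2 by (unfold mult; simpl; ring).
    apply (filterlim_comp_2 (G := locally 0) (H := locally (exp (- 0)))
             (fun t => Rpower t x) (fun t => exp (- t)) Rmult);
      [now apply filterlim_Rpower_0| |apply (filterlim_mult (K := R_AbsRing))].
    apply (filterlim_filter_le_1 (F := locally 0)).
    - intros P hP; now apply filter_le_within.
    - apply (ex_derive_continuous (fun t => exp (- t))); eexists; apply is_derive_exp_opp. }
  assert (hinf : filterlim F (Rbar_locally p_infty) (locally 0)).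
  { destruct (Rpower_le_exp x) as [C hC].
    apply (filterlim_le_le (fun _ => 0) F (fun t => C * exp (- (t / 2))) 0).
    - exists 1; intros t ht; split.
      + apply Rmult_le_pos; left; [apply Rpower_pos|apply exp_pos].
      + apply Rle_trans with (C * exp (t / 2) * exp (- t)).
        * apply Rmult_le_compat_r; [left; apply exp_pos|apply hC; lra].
        * right; rewrite Rmult_assoc, <- exp_plus; do 2 f_equal; field.
    - apply filterlim_const.
    - change (is_lim (fun t => C * exp (- (t / 2))) p_infty 0).
      replace (Finite 0) with (Rbar_mult C 0) by (simpl; f_equal; ring).
      apply is_lim_scal_l.
      apply (filterlim_comp _ _ _ (fun t => - (t / 2)) exp _ (Rbar_locally m_infty));
        [|apply is_lim_exp_m].
      intros P [M HM]; exists (- 2 * M); intros t ht; apply HM; lra. }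
  assert (hF : is_RInt_gen (fun t => x * (Rpower t (x - 1) * exp (- t)) - Rpower t (x + 1 - 1) * exp (- t))
                 (at_right 0) (Rbar_locally p_infty) (0 - 0)).
  { apply (is_RInt_gen_antiderivative _ _ F); auto.
    apply (filter_prod_pos_half_line _ 1 1); [lra|]; intros u v hu hv; simpl.
    rewrite Rmin_left by lra; intros t ht; split.
    - evar_last.
      + apply (is_derive_mult (fun t => Rpower t x) (fun t => exp (- t)));
          [apply is_derive_Rpower; lra|apply is_derive_exp_opp|intros; apply Rmult_comm].
      + unfold plus, mult; simpl. replace (x + 1 - 1) with x by ring. ring.
    - apply (continuous_minus (fun t => x * (Rpower t (x - 1) * exp (- t)))
               (fun t => Rpower t (x + 1 - 1) * exp (- t))).
      + apply (continuous_mult (fun _ => x) (fun t => Rpower t (x - 1) * exp (- t)));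
          [apply continuous_const|apply continuous_euler_integrand; lra].
      + apply continuous_euler_integrand; lra. }
  assert (h1 := is_RInt_gen_scal _ x _ (Gamma_euler_converges x hx)).
  assert (h2 := Gamma_euler_converges (x + 1) ltac:(lra)).
  assert (h3 := is_RInt_gen_minus _ _ _ _ h1 h2).
  assert (h : 0 - 0 = x * Gamma_euler x - Gamma_euler (x + 1)).
  { rewrite <- (is_RInt_gen_unique _ _ hF); exact (is_RInt_gen_unique _ _ h3). }
  lra.
Qed.

Lemma up_opp_pos (x : R) : 0 < x -> Z.to_nat (up (- x)) = 0%nat.
Proof.
  intros hx; destruct (archimed (- x)) as [h1 h2].
  assert (h : (up (- x) < 1)%Z) by (apply lt_IZR; lra). lia.
Qed.

Lemma Gamma_of_pos (x : R) : 0 < x -> Gamma x = Gamma_euler x.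
Proof.
  intros hx; unfold Gamma; rewrite up_opp_pos by exact hx; simpl.
  rewrite Rplus_0_r; field.
Qed.

Lemma Gamma_pos (x : R) : 0 < x -> 0 < Gamma x.
Proof. intros hx; rewrite Gamma_of_pos by exact hx; now apply Gamma_euler_pos. Qed.

Lemma rising_shift (x : R) (n : nat) : rising x (S n) = x * rising (x + 1) n.
Proof.
  induction n as [|n IH]; [simpl; ring|].
  change (rising x (S n) * (x + INR (S n)) = x * (rising (x + 1) n * (x + 1 + INR n))).
  rewrite IH, S_INR; ring.
Qed.

(** For [x <= 0] the continuations of [x] and [x + 1] stop at the same value of
[Gamma_euler], and the rising products differ by the factor [x].  This also holds at the
negative integers, where both sides have the inverse of 0 as a factor. *)
Lemma Gamma_plus_1 (x : R) : x <> 0 -> Gamma (x + 1) = x * Gamma x.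
Proof.
  intros hx.
  destruct (Rlt_or_le 0 x) as [h|h].
  - rewrite !Gamma_of_pos by lra; now apply Gamma_euler_plus_1.
  - unfold Gamma.
    assert (hup : up (- x) = (up (- (x + 1)) + 1)%Z).
    { symmetry; destruct (archimed (- (x + 1))) as [h1 h2].
      apply tech_up; rewrite plus_IZR; lra. }
    assert (hge : (0 <= up (- (x + 1)))%Z).
    { destruct (archimed (- (x + 1))) as [h1 h2].
      assert (-1 < up (- (x + 1)))%Z by (apply lt_IZR; lra). lia. }
    rewrite hup, Z2Nat.inj_add by lia.
    change (Z.to_nat 1) with 1%nat; rewrite Nat.add_1_r.
    set (n := Z.to_nat (up (- (x + 1)))).
    rewrite rising_shift, S_INR; unfold Rdiv; rewrite Rinv_mult.
    replace (x + 1 + INR n) with (x + (INR n + 1)) by ring.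
    set (g := Gamma_euler _); set (r := / rising _ _); now field.
Qed.

(** * Jacobi polynomials through their recurrence *)

(** A family given by the recurrence has explicit derivatives, given by differentiating
the recurrence, so every identity below is an induction and a computation.  The case
[n = 1] is separate because [recA c d 0] is a quotient by 0 when [c + d = -1]. *)
Fixpoint jac (c d : R) (n : nat) (s : R) : R :=
  match n with
  | O => 1
  | S n' =>
    match n' with
    | O => c + 1 + (c + d + 2) * (s - 1) / 2
    | S n'' => (recA c d n' * s - recB c d n') * jac c d n' s - recC c d n' * jac c d n'' s
    end
  end.

Fixpoint jac' (c d : R) (n : nat) (s : R) : R :=
  match n with
  | O => 0
  | S n' =>
    match n' with
    | O => (c + d + 2) / 2
    | S n'' => recA c d n' * jac c d n' s + (recA c d n' * s - recB c d n') * jac' c d n' s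
               - recC c d n' * jac' c d n'' s
    end
  end.

Fixpoint jac'' (c d : R) (n : nat) (s : R) : R :=
  match n with
  | O => 0
  | S n' =>
    match n' with
    | O => 0
    | S n'' => 2 * recA c d n' * jac' c d n' s + (recA c d n' * s - recB c d n') * jac'' c d n' s
               - recC c d n' * jac'' c d n'' s
    end
  end.

Lemma jac_SS (c d : R) (n : nat) (s : R) :
  jac c d (S (S n)) s =
  (recA c d (S n) * s - recB c d (S n)) * jac c d (S n) s - recC c d (S n) * jac c d n s.
Proof. reflexivity. Qed.

Lemma jac'_SS (c d : R) (n : nat) (s : R) :
  jac' c d (S (S n)) s =
  recA c d (S n) * jac c d (S n) s + (recA c d (S n) * s - recB c d (S n)) * jac' c d (S n) s
  - recC c d (S n) * jac' c d n s.
Proof. reflexivity. Qed.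

Lemma jac''_SS (c d : R) (n : nat) (s : R) :
  jac'' c d (S (S n)) s =
  2 * recA c d (S n) * jac' c d (S n) s + (recA c d (S n) * s - recB c d (S n)) * jac'' c d (S n) s
  - recC c d (S n) * jac'' c d n s.
Proof. reflexivity. Qed.

Lemma nat_ind_step2 (Q : nat -> Prop) :
  Q 0%nat -> Q 1%nat -> (forall n, Q n -> Q (S n) -> Q (S (S n))) -> forall n, Q n.
Proof.
  intros h0 h1 hS n; enough (Q n /\ Q (S n)) by tauto.
  induction n as [|n [IH1 IH2]]; auto.
Qed.

Lemma is_derive_three_term (a b e : R) (f g : R -> R) (f' g' s : R) :
  is_derive f s f' -> is_derive g s g' ->
  is_derive (fun s => (a * s - b) * f s - e * g s) s (a * f s + (a * s - b) * f' - e * g').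
Proof.
  intros hf hg; auto_derive; [repeat split; eexists; eassumption|].
  change (fun x : R => f x) with f; change (fun x : R => g x) with g.
  rewrite (is_derive_unique _ _ _ hf), (is_derive_unique _ _ _ hg); ring.
Qed.

Lemma is_derive_jac (c d : R) (n : nat) (s : R) :
  is_derive (jac c d n) s (jac' c d n s).
Proof.
  induction n as [| |n IH1 IH2] using nat_ind_step2.
  - apply (is_derive_const 1).
  - unfold jac, jac'; auto_derive; [easy|field].
  - now apply (is_derive_three_term _ _ _ (jac c d (S n)) (jac c d n)).
Qed.

Lemma is_derive_jac' (c d : R) (n : nat) (s : R) :
  is_derive (jac' c d n) s (jac'' c d n s).
Proof.
  induction n as [| |n IH1 IH2] using nat_ind_step2.
  - apply (is_derive_const 0).
  - apply (is_derive_const ((c + d + 2) / 2)).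
  - apply (is_derive_ext (fun s => recA c d (S n) * jac c d (S n) s
      + ((recA c d (S n) * s - recB c d (S n)) * jac' c d (S n) s
         - recC c d (S n) * jac' c d n s))).
    { intros t; rewrite jac'_SS; apply Rminus_diag_uniq; ring. }
    evar_last.
    + apply (is_derive_plus (fun s => recA c d (S n) * jac c d (S n) s)).
      * apply is_derive_scal, is_derive_jac.
      * exact (is_derive_three_term _ _ _ (jac' c d (S n)) (jac' c d n) _ _ _ IH2 IH1).
    + rewrite jac''_SS; unfold plus; simpl; ring.
Qed.

(** Classically, [(1 - s^2) P_n'] is a combination of [P_n] with either neighbour.  For a
given [n] the relation with the lower neighbour implies that with the upper one through
the three-term recurrence.  Differentiating the recurrence for [P_(n+2)] and inserting
the upper relation for [P_n] and the lower one for [P_(n+1)] gives the lower one for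
[P_(n+2)].  This fixes the pairing of indices in the induction. *)
Lemma ladder (c d : R) (n : nat) (s : R) : -1 < c -> -1 < d ->
  let x := INR n in
  (2 * x + c + d + 2) * ((1 - s ^ 2) * jac' c d n s) =
    (x + c + d + 1) * ((c - d + (2 * x + c + d + 2) * s) * jac c d n s
                       - 2 * (x + 1) * jac c d (S n) s)
  /\
  (2 * x + c + d + 2) * ((1 - s ^ 2) * jac' c d (S n) s) =
    (x + 1) * (c - d - (2 * x + c + d + 2) * s) * jac c d (S n) s
    + 2 * (x + 1 + c) * (x + 1 + d) * jac c d n s.
Proof.
  intros hc hd; cbv zeta; induction n as [|n [IHr IHl]].
  - simpl; split; field.
  - set (x := INR n) in *.
    assert (hx : 0 <= x) by apply pos_INR.
    assert (e0 : 2 * x + c + d + 2 <> 0) by lra.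
    assert (hr : (1 - s ^ 2) * jac' c d n s = (x + c + d + 1) * ((c - d + (2 * x + c + d + 2) * s) * jac c d n s
                       - 2 * (x + 1) * jac c d (S n) s) / (2 * x + c + d + 2)).
    { rewrite <- IHr; now field. }
    assert (hl : (1 - s ^ 2) * jac' c d (S n) s = ((x + 1) * (c - d - (2 * x + c + d + 2) * s) * jac c d (S n) s
    + 2 * (x + 1 + c) * (x + 1 + d) * jac c d n s) / (2 * x + c + d + 2)).
    { rewrite <- IHl; now field. }
    rewrite S_INR; fold x.
    (* The recurrence for the derivative, multiplied by [1 - s^2]: the induction hypotheses
       then express the right-hand side in [jac n] and [jac (n + 1)] alone. *)
    assert (hl' : (2 * (x + 1) + c + d + 2) * ((1 - s ^ 2) * jac' c d (S (S n)) s) =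
      (2 * (x + 1) + c + d + 2) * (recA c d (S n) * ((1 - s ^ 2) * jac c d (S n) s)
       + (recA c d (S n) * s - recB c d (S n)) * ((1 - s ^ 2) * jac' c d (S n) s)
       - recC c d (S n) * ((1 - s ^ 2) * jac' c d n s))).
    { rewrite jac'_SS; ring. }
    rewrite hl', hr, hl, jac_SS.
    generalize (jac c d (S n) s) (jac c d n s); intros p q.
    unfold recA, recB, recC; rewrite S_INR; fold x.
    split; field; lra.
Qed.

Lemma continuous_jac (c d : R) (n : nat) (s : R) : continuous (jac c d n) s.
Proof. apply (ex_derive_continuous (jac c d n)); eexists; apply is_derive_jac. Qed.

Lemma continuous_jac' (c d : R) (n : nat) (s : R) : continuous (jac' c d n) s.
Proof. apply (ex_derive_continuous (jac' c d n)); eexists; apply is_derive_jac'. Qed.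

(** The factor [1 - s^2] vanishes at 1, so the first ladder relation becomes a relation
between the values of neighbouring polynomials. *)
Lemma jac_S_at_1 (c d : R) (n : nat) : -1 < c -> -1 < d ->
  (INR n + 1) * jac c d (S n) 1 = (INR n + c + 1) * jac c d n 1.
Proof.
  intros hc hd; destruct n as [|n]; [simpl; field|].
  destruct (ladder c d (S n) 1 hc hd) as [h _].
  assert (hx : 1 <= INR (S n)) by (rewrite S_INR; assert (h0 := pos_INR n); lra).
  apply (Rmult_eq_reg_l (2 * (INR (S n) + c + d + 1))); [|lra].
  set (x := INR (S n)) in *.
  replace (1 - 1 ^ 2) with 0 in h by ring.
  revert h; generalize (jac c d (S (S n)) 1) (jac c d (S n) 1); intros p q h; lra.
Qed.

Lemma jac_at_1 (c d : R) (n : nat) : -1 < c -> -1 < d ->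
  jac c d n 1 = Gamma (INR n + c + 1) / (INR (fact n) * Gamma (c + 1)).
Proof.
  intros hc hd.
  assert (hg : 0 < Gamma (c + 1)) by (apply Gamma_pos; lra).
  induction n as [|n IH].
  - simpl; rewrite Rplus_0_l; field; lra.
  - assert (hn := pos_INR n); assert (hf := INR_fact_lt_0 n).
    assert (h := jac_S_at_1 c d n hc hd).
    apply (Rmult_eq_reg_l (INR n + 1)); [|lra].
    rewrite h, IH, S_INR.
    replace (INR n + 1 + c + 1) with (INR n + c + 1 + 1) by ring.
    rewrite (Gamma_plus_1 (INR n + c + 1)) by lra.
    rewrite fact_simpl, mult_INR, S_INR; field; lra.
Qed.

Lemma jac_at_1_pos (c d : R) (n : nat) : -1 < c -> -1 < d -> 0 < jac c d n 1.
Proof.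
  intros hc hd; rewrite jac_at_1 by assumption.
  assert (hn := pos_INR n); assert (hf := INR_fact_lt_0 n).
  apply Rdiv_lt_0_compat; [|apply Rmult_lt_0_compat; [exact hf|]]; apply Gamma_pos; lra.
Qed.

(** Differentiate the second ladder relation and eliminate the remaining first
derivatives with the two relations themselves.  This elimination multiplies by
[1 - s^2], which is why the points [1] and [-1] are left out. *)
Lemma jacobi_ode (c d : R) (n : nat) (s : R) : -1 < c -> -1 < d -> 1 - s ^ 2 <> 0 ->
  (1 - s ^ 2) * jac'' c d n s + (d - c - (c + d + 2) * s) * jac' c d n s
  = - (INR n * (INR n + c + d + 1)) * jac c d n s.
Proof.
  intros hc hd hs; destruct n as [|n]; [simpl; ring|].
  destruct (ladder c d n s hc hd) as [hr hl].
  assert (hx : 0 <= INR n) by apply pos_INR.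
  rewrite S_INR; set (x := INR n) in *.
  assert (hd' : (2 * x + c + d + 2) * ((1 - s ^ 2) * jac'' c d (S n) s - 2 * s * jac' c d (S n) s) =
    (x + 1) * ((c - d - (2 * x + c + d + 2) * s) * jac' c d (S n) s
               - (2 * x + c + d + 2) * jac c d (S n) s)
    + 2 * (x + 1 + c) * (x + 1 + d) * jac' c d n s).
  { assert (h1 : is_derive (fun s => (2 * x + c + d + 2) * ((1 - s ^ 2) * jac' c d (S n) s)) s
      ((2 * x + c + d + 2) * ((1 - s ^ 2) * jac'' c d (S n) s - 2 * s * jac' c d (S n) s))).
    { assert (h := is_derive_jac' c d (S n) s); revert h.
      generalize (jac' c d (S n)) (jac'' c d (S n) s); intros f f' h.
      auto_derive; [repeat split; eexists; eassumption|].
      change (fun x : R => f x) with f; rewrite (is_derive_unique _ _ _ h); ring. }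
    assert (h2 : is_derive (fun s => (2 * x + c + d + 2) * ((1 - s ^ 2) * jac' c d (S n) s)) s
      ((x + 1) * ((c - d - (2 * x + c + d + 2) * s) * jac' c d (S n) s
               - (2 * x + c + d + 2) * jac c d (S n) s)
    + 2 * (x + 1 + c) * (x + 1 + d) * jac' c d n s)).
    { apply (is_derive_ext (fun s => (x + 1) * (c - d - (2 * x + c + d + 2) * s) * jac c d (S n) s
        + 2 * (x + 1 + c) * (x + 1 + d) * jac c d n s)).
      { intros t; symmetry; apply (ladder c d n t hc hd). }
      assert (h := is_derive_jac c d (S n) s); assert (h' := is_derive_jac c d n s); revert h h'.
      generalize (jac c d (S n)) (jac' c d (S n) s) (jac c d n) (jac' c d n s); intros f f' g g' h h'.
      auto_derive; [repeat split; eexists; eassumption|].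
      change (fun x : R => f x) with f; change (fun x : R => g x) with g.
      rewrite (is_derive_unique _ _ _ h), (is_derive_unique _ _ _ h'); ring. }
    rewrite <- (is_derive_unique _ _ _ h1); exact (is_derive_unique _ _ _ h2). }
  revert hr hl hd'; generalize (jac'' c d (S n) s) (jac' c d (S n) s) (jac c d (S n) s) (jac' c d n s) (jac c d n s).
  intros r p' p q' q hr hl hd'.
  assert (hw : 0 < 2 * x + c + d + 2) by lra.
  set (w := 1 - s ^ 2) in *.
  apply (Rmult_eq_reg_l (w * (2 * x + c + d + 2)^2)).
  2:{ apply Rmult_integral_contrapositive; split; [exact hs|apply pow_nonzero; lra]. }
  (* With these multipliers the terms in [p'] and [q'] cancel, and the three relations add
     up to the equation. *)
  assert (m1 := f_equal (Rmult (w * (2 * x + c + d + 2))) hd').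
  assert (m2 := f_equal (Rmult ((2 * x + c + d + 2) * (d - c - (c + d) * s)
                  + (x + 1) * (c - d - (2 * x + c + d + 2) * s))) hl).
  assert (m3 := f_equal (Rmult (2 * (x + 1 + c) * (x + 1 + d))) hr).
  unfold w in *; lra.
Qed.

Lemma continuous_jac'' (c d : R) (n : nat) (s : R) : continuous (jac'' c d n) s.
Proof.
  induction n as [| |n IH1 IH2] using nat_ind_step2; [apply continuous_const..|].
  apply (continuous_minus (fun s => 2 * recA c d (S n) * jac' c d (S n) s
    + (recA c d (S n) * s - recB c d (S n)) * jac'' c d (S n) s) (fun s => recC c d (S n) * jac'' c d n s)).
  - apply (continuous_plus (fun s => 2 * recA c d (S n) * jac' c d (S n) s)
      (fun s => (recA c d (S n) * s - recB c d (S n)) * jac'' c d (S n) s)).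
    + apply (continuous_scal_r (2 * recA c d (S n)) (jac' c d (S n))), continuous_jac'.
    + apply (continuous_mult (fun s => recA c d (S n) * s - recB c d (S n)) (jac'' c d (S n))); [|exact IH2].
      apply (ex_derive_continuous (fun s => recA c d (S n) * s - recB c d (S n))); auto_derive; easy.
  - apply (continuous_scal_r (recC c d (S n)) (jac'' c d n)), IH1.
Qed.

Lemma continuous_nonzero_near (h : R -> R) (s : R) : continuous h s -> h s <> 0 ->
  exists e, 0 < e /\ forall t, s - e < t < s + e -> h t <> 0.
Proof.
  intros hc hne; assert (hpos : 0 < Rabs (h s)) by now apply Rabs_pos_lt.
  destruct (proj1 (filterlim_locally h (h s)) hc (mkposreal _ hpos)) as [[e he] hl]; simpl in hl.
  exists e; split; [exact he|]; intros t ht e0.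
  assert (hb : ball s e t) by (apply ball_R; lra).
  apply hl, ball_R in hb; simpl in hb; rewrite e0 in hb.
  revert hb hpos; unfold Rabs; destruct (Rcase_abs (h s)); lra.
Qed.

Lemma continuous_eq_0_of_limit (h : R -> R) (s : R) :
  continuous h s -> (forall e, 0 < e -> exists t, s - e < t < s + e /\ h t = 0) -> h s = 0.
Proof.
  intros hc h0.
  destruct (Req_dec (h s) 0) as [e|hne]; [exact e|exfalso].
  destruct (continuous_nonzero_near h s hc hne) as (e & he & hnz).
  destruct (h0 e he) as (t & ht & e0); exact (hnz t ht e0).
Qed.

(** After multiplication by [1 - s^2] the ladder relations turn the claim into an
identity between [jac n] and [jac (n + 1)]; the endpoints follow by continuity. *)
Lemma jac_eq_derivatives (c d : R) (n : nat) (s : R) : -1 < c -> -1 < d ->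
  jac c d (S n) s = hatA c d (S n) * jac' c d n s + hatB c d (S n) * jac' c d (S n) s
                    + hatC c d (S n) * jac' c d (S (S n)) s.
Proof.
  intros hc hd.
  set (h := fun s => hatA c d (S n) * jac' c d n s + hatB c d (S n) * jac' c d (S n) s
                    + hatC c d (S n) * jac' c d (S (S n)) s - jac c d (S n) s).
  enough (hs : h s = 0) by (unfold h in hs; lra).
  assert (hgen : forall t, 1 - t ^ 2 <> 0 -> h t = 0).
  { intros t ht; apply (Rmult_eq_reg_l (1 - t ^ 2)); [|exact ht].
    destruct (ladder c d n t hc hd) as [hr hl].
    destruct (ladder c d (S n) t hc hd) as [_ hl2].
    assert (hx : 0 <= INR n) by apply pos_INR.
    rewrite S_INR in hl2; set (x := INR n) in *.
    assert (e0 : (1 - t ^ 2) * jac' c d n t = (x + c + d + 1) * ((c - d + (2 * x + c + d + 2) * t) * jac c d n t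
                       - 2 * (x + 1) * jac c d (S n) t) / (2 * x + c + d + 2)).
    { rewrite <- hr; field; lra. }
    assert (e1 : (1 - t ^ 2) * jac' c d (S n) t = ((x + 1) * (c - d - (2 * x + c + d + 2) * t) * jac c d (S n) t
    + 2 * (x + 1 + c) * (x + 1 + d) * jac c d n t) / (2 * x + c + d + 2)).
    { rewrite <- hl; field; lra. }
    assert (e2 : (1 - t ^ 2) * jac' c d (S (S n)) t =
      ((x + 1 + 1) * (c - d - (2 * (x + 1) + c + d + 2) * t) * jac c d (S (S n)) t
      + 2 * (x + 1 + 1 + c) * (x + 1 + 1 + d) * jac c d (S n) t) / (2 * (x + 1) + c + d + 2)).
    { rewrite <- hl2; field; lra. }
    transitivity (hatA c d (S n) * ((1 - t ^ 2) * jac' c d n t) + hatB c d (S n) * ((1 - t ^ 2) * jac' c d (S n) t)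
                    + hatC c d (S n) * ((1 - t ^ 2) * jac' c d (S (S n)) t) - (1 - t ^ 2) * jac c d (S n) t).
    { unfold h; ring. }
    (* The first ladder relation carries the factor [x + c + d + 1], which cancels the pole
       of [hatA].  If this factor is 0, then [n = 0], and [hatA] multiplies the derivative of
       the constant [jac 0]. *)
    assert (eA : hatA c d (S n) * (x + c + d + 1) =
      - 2 * (x + 1 + c) * (x + 1 + d) / ((2 * x + c + d + 2) * (2 * x + c + d + 3))
      \/ (x = 0 /\ c + d + 1 = 0)).
    { unfold hatA; rewrite S_INR; fold x.
      destruct (Req_EM_T (x + 1 + c + d) 0) as [e|ne]; [right|left; field; lra].
      destruct n as [|n]; [unfold x in *; simpl in *; lra|].
      exfalso; revert e; unfold x; rewrite S_INR; assert (h9 := pos_INR n); lra. }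
    destruct eA as [eA|[ex ecd]].
    - rewrite e0, e1, e2, jac_SS.
      generalize (jac c d (S n) t) (jac c d n t); intros p q.
      transitivity ((hatA c d (S n) * (x + c + d + 1)) * (((c - d + (2 * x + c + d + 2) * t) * q
                       - 2 * (x + 1) * p) / (2 * x + c + d + 2)) +
       hatB c d (S n) * (((x + 1) * (c - d - (2 * x + c + d + 2) * t) * p + 2 * (x + 1 + c) * (x + 1 + d) * q) / (2 * x + c + d + 2)) +
       hatC c d (S n) * (((x + 1 + 1) * (c - d - (2 * (x + 1) + c + d + 2) * t) *
        ((recA c d (S n) * t - recB c d (S n)) * p - recC c d (S n) * q) +
        2 * (x + 1 + 1 + c) * (x + 1 + 1 + d) * p) / (2 * (x + 1) + c + d + 2)) -
       (1 - t ^ 2) * p); [field; lra|].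
      rewrite eA; unfold hatB, hatC, recA, recB, recC; rewrite S_INR; fold x; field; lra.
    - assert (hn : n = 0%nat) by (apply INR_eq; exact ex).
      subst n; clear x hr hl hl2 hx e0 e1 e2 ex h.
      replace d with (- 1 - c) by lra.
      unfold hatA, hatB, hatC, jac', jac, recA, recB, recC; simpl; field; lra. }
  destruct (Req_dec (1 - s ^ 2) 0) as [e|ne]; [|now apply hgen].
  apply continuous_eq_0_of_limit.
  - unfold h.
    apply (ex_derive_continuous (fun s => hatA c d (S n) * jac' c d n s + hatB c d (S n) * jac' c d (S n) s
                    + hatC c d (S n) * jac' c d (S (S n)) s - jac c d (S n) s)).
    assert (i0 := is_derive_jac c d (S n) s); assert (i1 := is_derive_jac' c d n s).
    assert (i2 := is_derive_jac' c d (S n) s); assert (i3 := is_derive_jac' c d (S (S n)) s).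
    auto_derive; repeat split; eexists; eassumption.
  - intros e' he'; exists (s + Rmin e' 1 / 2).
    assert (hm := Rmin_l e' 1); assert (hm' := Rmin_r e' 1).
    assert (hm0 := Rmin_pos e' 1 he' Rlt_0_1); split; [lra|apply hgen].
    set (m := Rmin e' 1) in *.
    destruct (Rle_or_lt 0 s); nra.
Qed.

Lemma is_derive_hatSum (c d : R) (n : nat) (s : R) : -1 < c -> -1 < d -> (1 <= n)%nat ->
  is_derive (hatSum c d (jac c d) n) s (jac c d n s).
Proof.
  intros hc hd hn; destruct n as [|n]; [lia|].
  rewrite jac_eq_derivatives by assumption.
  unfold hatSum; replace (S n - 1)%nat with n by lia; rewrite Nat.add_1_r.
  apply (is_derive_plus (fun s => hatA c d (S n) * jac c d n s + hatB c d (S n) * jac c d (S n) s)).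
  - apply (is_derive_plus (fun s => hatA c d (S n) * jac c d n s)); apply is_derive_scal, is_derive_jac.
  - apply is_derive_scal, is_derive_jac.
Qed.

(** * Orthogonality and uniqueness *)

Definition weight (c d s : R) : R := Rpower (1 - s) c * Rpower (1 + s) d.

(** A predicate that includes convergence: it is linear in [f] without a case distinction
on integrability. *)
Definition null_integral (c d : R) (f : R -> R) : Prop :=
  is_RInt_gen (fun s => f s * weight c d s) (at_right (-1)) (at_left 1) 0.

Lemma filter_prod_unit_interval (P : R * R -> Prop) (a b : R) :
  -1 < a -> b < 1 -> (forall u v, -1 < u < a -> b < v < 1 -> P (u, v)) ->
  filter_prod (at_right (-1)) (at_left 1) P.
Proof.
  intros ha hb hP.
  apply (Filter_prod _ _ _ (fun u => -1 < u < a) (fun v => b < v < 1)); auto.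
  - assert (ha' : 0 < a + 1) by lra; exists (mkposreal _ ha'); intros x hx hx0.
    apply ball_R in hx; simpl in hx; lra.
  - assert (hb' : 0 < 1 - b) by lra; exists (mkposreal _ hb'); intros x hx hx0.
    apply ball_R in hx; simpl in hx; lra.
Qed.

Lemma null_integral_ext (c d : R) (f g : R -> R) :
  (forall s, -1 < s < 1 -> f s = g s) -> null_integral c d f -> null_integral c d g.
Proof.
  intros h; unfold null_integral.
  apply (is_RInt_gen_ext (fun s => f s * weight c d s) (fun s => g s * weight c d s)).
  apply (filter_prod_unit_interval _ 0 0); [lra|lra|]; intros u v hu hv; simpl.
  rewrite Rmin_left, Rmax_right by lra; intros x hx; rewrite h by lra; reflexivity.
Qed.

Lemma null_integral_combine (c d a b : R) (f g : R -> R) :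
  null_integral c d f -> null_integral c d g ->
  null_integral c d (fun s => a * f s + b * g s).
Proof.
  unfold null_integral; intros hf hg.
  assert (h := is_RInt_gen_plus _ _ _ _ (is_RInt_gen_scal _ a _ hf) (is_RInt_gen_scal _ b _ hg)).
  unfold plus, scal in h; simpl in h; unfold mult in h; simpl in h.
  replace (a * 0 + b * 0) with 0 in h by ring.
  revert h; apply is_RInt_gen_ext.
  apply filter_forall; intros ab x _; simpl; ring.
Qed.

(** Pearson's equation for the weight: [((1 - s^2) w)'] is a polynomial of degree at most 1
times [w], where [(1 - s^2) w] is the weight with both exponents increased by 1. *)
Lemma is_derive_weight (c d s : R) : -1 < s < 1 ->
  is_derive (weight (c + 1) (d + 1)) s ((d - c - (c + d + 2) * s) * weight c d s).
Proof.
  intros hs; unfold weight; evar_last.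
  - apply (is_derive_mult (fun s => Rpower (1 - s) (c + 1)) (fun s => Rpower (1 + s) (d + 1))).
    + apply (is_derive_comp (fun t => Rpower t (c + 1)) (fun s => 1 - s)).
      * apply is_derive_Rpower; lra.
      * instantiate (1 := -1); auto_derive; [easy|ring].
    + apply (is_derive_comp (fun t => Rpower t (d + 1)) (fun s => 1 + s)).
      * apply is_derive_Rpower; lra.
      * instantiate (1 := 1); auto_derive; [easy|ring].
    + intros; apply Rmult_comm.
  - unfold plus, mult, scal; simpl; unfold mult; simpl.
    replace (c + 1 - 1) with c by ring; replace (d + 1 - 1) with d by ring.
    rewrite !Rpower_plus_1 by lra; ring.
Qed.

Lemma continuous_weight (c d s : R) : -1 < s < 1 -> continuous (weight c d) s.
Proof.
  intros hs; replace c with (c - 1 + 1) by ring; replace d with (d - 1 + 1) by ring.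
  apply (ex_derive_continuous (weight (c - 1 + 1) (d - 1 + 1))); eexists.
  now apply is_derive_weight.
Qed.

(** This is where [d > -1] is needed: the exponent [d + 1] is positive. *)
Lemma filterlim_weight_right (c d : R) : -1 < d ->
  filterlim (weight (c + 1) (d + 1)) (at_right (-1)) (locally 0).
Proof.
  intros hd.
  replace 0 with (Rpower (1 - -1) (c + 1) * 0) by ring.
  apply (filterlim_comp_2 (G := locally (Rpower (1 - -1) (c + 1))) (H := locally 0)
             (fun s => Rpower (1 - s) (c + 1)) (fun s => Rpower (1 + s) (d + 1)) Rmult);
      [| |apply (filterlim_mult (K := R_AbsRing))].
  - apply (filterlim_filter_le_1 (F := locally (-1))).
    + intros P hP; now apply filter_le_within.
    + apply (continuous_comp (fun s => 1 - s) (fun t => Rpower t (c + 1))).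
      * apply (ex_derive_continuous (fun s => 1 - s)); auto_derive; easy.
      * apply continuous_Rpower; lra.
  - apply (filterlim_comp _ _ _ (fun s => 1 + s) (fun t => Rpower t (d + 1)) _ (at_right 0));
      [|apply filterlim_Rpower_0; lra].
    intros P [e he]; exists e; intros s hs h; apply he; [|lra].
    apply ball_R in hs; apply ball_R; lra.
Qed.

Lemma weight_opp (c d s : R) : weight c d (- s) = weight d c s.
Proof.
  unfold weight; replace (1 - - s) with (1 + s) by ring.
  replace (1 + - s) with (1 - s) by ring; ring.
Qed.

Lemma filterlim_weight_left (c d : R) : -1 < c ->
  filterlim (weight (c + 1) (d + 1)) (at_left 1) (locally 0).
Proof.
  intros hc.
  apply (filterlim_ext (fun s => weight (d + 1) (c + 1) (- s))); [intros s; apply weight_opp|].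
  apply (filterlim_comp _ _ _ Ropp (weight (d + 1) (c + 1)) _ (at_right (-1)));
    [|now apply filterlim_weight_right].
  apply filterlim_Ropp_left.
Qed.

(** The integrand times the weight is the derivative of [(1 - s^2) w q], which vanishes at
both ends. *)
Lemma null_integral_pearson (c d : R) (q q1 : R -> R) : -1 < c -> -1 < d ->
  (forall s, is_derive q s (q1 s)) -> (forall s, continuous q1 s) ->
  null_integral c d (fun s => (1 - s ^ 2) * q1 s + (d - c - (c + d + 2) * s) * q s).
Proof.
  intros hc hd hq hq1; unfold null_integral.
  assert (hcq : forall s, continuous q s).
  { intros s; apply (ex_derive_continuous q); eexists; apply hq. }
  replace 0 with (0 - 0) by ring.
  apply (is_RInt_gen_antiderivative _ _ (fun s => q s * weight (c + 1) (d + 1) s)).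
  - apply (filter_prod_unit_interval _ 0 0); [lra|lra|]; intros u v hu hv; simpl.
    rewrite Rmin_left, Rmax_right by lra; intros s hs; split.
    + evar_last.
      * apply (is_derive_mult q (weight (c + 1) (d + 1)));
          [apply hq|apply is_derive_weight; lra|intros; apply Rmult_comm].
      * unfold plus, mult; simpl; unfold weight.
        rewrite !Rpower_plus_1 by lra; ring.
    + apply (continuous_mult (fun s => (1 - s * (s * 1)) * q1 s + (d - c - (c + d + 2) * s) * q s) (weight c d));
        [|apply continuous_weight; lra].
      apply (continuous_plus (fun s => (1 - s * (s * 1)) * q1 s) (fun s => (d - c - (c + d + 2) * s) * q s)).
      * apply (continuous_mult (fun s => 1 - s * (s * 1)) q1); [|apply hq1].
        apply (ex_derive_continuous (fun s => 1 - s * (s * 1))); auto_derive; easy.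
      * apply (continuous_mult (fun s => d - c - (c + d + 2) * s) q); [|apply hcq].
        apply (ex_derive_continuous (fun s => d - c - (c + d + 2) * s)); auto_derive; easy.
  - replace 0 with (q (-1) * 0) by ring.
    apply (filterlim_comp_2 (G := locally (q (-1))) (H := locally 0)
             q (weight (c + 1) (d + 1)) Rmult);
      [|now apply filterlim_weight_right|apply (filterlim_mult (K := R_AbsRing))].
    apply (filterlim_filter_le_1 (F := locally (-1))); [|apply hcq].
    intros P hP; now apply filter_le_within.
  - replace 0 with (q 1 * 0) by ring.
    apply (filterlim_comp_2 (G := locally (q 1)) (H := locally 0)
             q (weight (c + 1) (d + 1)) Rmult);
      [|now apply filterlim_weight_left|apply (filterlim_mult (K := R_AbsRing))].
    apply (filterlim_filter_le_1 (F := locally 1)); [|apply hcq].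
    intros P hP; now apply filter_le_within.
Qed.

(** The Sturm-Liouville argument: with [q] the Wronskian of [jac i] and [jac j], the
differential equation turns the integrand of [null_integral_pearson] into
[(L j - L i) jac i jac j], where [L n = n (n + c + d + 1)] is the [n]-th eigenvalue. *)
Lemma jac_orthogonal (c d : R) (i j : nat) : -1 < c -> -1 < d -> i <> j ->
  null_integral c d (fun s => jac c d i s * jac c d j s).
Proof.
  intros hc hd hij.
  set (L := fun n => INR n * (INR n + c + d + 1)).
  assert (hL : L j - L i <> 0).
  (* The second factor is positive because [i + j >= 1] and [c + d > -2]. *)
  { assert (e : L j - L i = (INR j - INR i) * (INR i + INR j + c + d + 1)) by (unfold L; ring).
    rewrite e; apply Rmult_integral_contrapositive; split.
    - intros h; apply hij, INR_eq; lra.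
    - assert (h : 1 <= INR i + INR j) by (rewrite <- plus_INR; apply (le_INR 1); lia); lra. }
  assert (h := null_integral_pearson c d
    (fun s => jac' c d i s * jac c d j s - jac c d i s * jac' c d j s)
    (fun s => jac'' c d i s * jac c d j s - jac c d i s * jac'' c d j s) hc hd).
  assert (h1 : forall s, is_derive (fun s => jac' c d i s * jac c d j s - jac c d i s * jac' c d j s) s
     (jac'' c d i s * jac c d j s - jac c d i s * jac'' c d j s)).
  { intros s; evar_last.
    - apply (is_derive_minus (fun s => jac' c d i s * jac c d j s) (fun s => jac c d i s * jac' c d j s)).
      + apply (is_derive_mult (jac' c d i) (jac c d j));
          [apply is_derive_jac'|apply is_derive_jac|intros; apply Rmult_comm].
      + apply (is_derive_mult (jac c d i) (jac' c d j));
          [apply is_derive_jac|apply is_derive_jac'|intros; apply Rmult_comm].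
    - unfold minus, plus, opp, mult; simpl; ring. }
  assert (h2 : forall s, continuous (fun s => jac'' c d i s * jac c d j s - jac c d i s * jac'' c d j s) s).
  { intros s; apply (continuous_minus (fun s => jac'' c d i s * jac c d j s) (fun s => jac c d i s * jac'' c d j s));
      [apply (continuous_mult (jac'' c d i) (jac c d j))|apply (continuous_mult (jac c d i) (jac'' c d j))];
      auto using continuous_jac, continuous_jac''. }
  specialize (h h1 h2).
  assert (h3 := null_integral_combine c d (/ (L j - L i)) 0 _ _ h h).
  revert h3; apply null_integral_ext; intros s hs.
  assert (hs' : 1 - s ^ 2 <> 0) by nra.
  assert (oi := jacobi_ode c d i s hc hd hs'); assert (oj := jacobi_ode c d j s hc hd hs').
  fold (L i) in oi; fold (L j) in oj.
  apply (Rmult_eq_reg_l (L j - L i)); [|exact hL].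
  rewrite Rmult_plus_distr_l, <- Rmult_assoc, Rinv_r, Rmult_1_l by exact hL.
  transitivity (((1 - s ^ 2) * jac'' c d i s + (d - c - (c + d + 2) * s) * jac' c d i s) * jac c d j s
    - ((1 - s ^ 2) * jac'' c d j s + (d - c - (c + d + 2) * s) * jac' c d j s) * jac c d i s); [ring|].
  rewrite oi, oj; ring.
Qed.

(** The weight is positive, so by continuity a nonzero value of [D] would make the
integral positive. *)
Lemma null_integral_square (c d : R) (D : R -> R) :
  (forall s, -1 < s < 1 -> continuous D s) -> null_integral c d (fun s => D s * D s) ->
  forall s, -1 < s < 1 -> D s = 0.
Proof.
  intros hD h0 s hs.
  destruct (Req_dec (D s) 0) as [e|hne]; [exact e|exfalso].
  destruct (continuous_nonzero_near D s (hD s hs) hne) as (e & he & hnz).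
  set (a := Rmax (s - e / 2) ((s - 1) / 2)); set (b := Rmin (s + e / 2) ((s + 1) / 2)).
  assert (ha : -1 < a < s /\ s - e < a) by (unfold a, Rmax; destruct Rle_dec; lra).
  assert (hb : s < b < 1 /\ b < s + e) by (unfold b, Rmin; destruct Rle_dec; lra).
  assert (hw : forall t, 0 < weight c d t).
  { intros t; apply Rmult_lt_0_compat; apply Rpower_pos. }
  apply (Rlt_irrefl 0).
  refine (RInt_gen_gt_0 (at_right (-1)) (at_left 1) _ a b _ ltac:(lra) _ _ h0).
  - intros t ht; apply Rmult_lt_0_compat; [|apply hw].
    apply Rsqr_pos_lt, hnz; lra.
  - apply (filter_prod_unit_interval _ a b); [lra|lra|]; intros u v hu hv; simpl.
    split; [lra|split; [lra|]]; intros t ht; split.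
    + apply (continuous_mult (fun t => D t * D t) (weight c d)); [|apply continuous_weight; lra].
      apply (continuous_mult D D); apply hD; lra.
    + apply Rmult_le_pos; [apply Rle_0_sqr|left; apply hw].
Qed.

(** The span of [B 0, ..., B (n - 1)], by recursion on [n] so that changing the basis is
a single induction. *)
Fixpoint in_span (B : nat -> R -> R) (n : nat) (p : R -> R) : Prop :=
  match n with
  | O => forall s, p s = 0
  | S n' => exists l q, in_span B n' q /\ forall s, p s = l * B n' s + q s
  end.

Definition monomial (n : nat) (s : R) : R := s ^ n.

Lemma in_span_combine (B : nat -> R -> R) (n : nat) (a b : R) (p q : R -> R) :
  in_span B n p -> in_span B n q -> in_span B n (fun s => a * p s + b * q s).
Proof.
  revert p q; induction n as [|n IH]; intros p q; simpl.
  - intros hp hq s; rewrite hp, hq; ring.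
  - intros (l & p' & hp' & hp) (m & q' & hq' & hq).
    exists (a * l + b * m), (fun s => a * p' s + b * q' s); split; [now apply IH|].
    intros s; rewrite hp, hq; ring.
Qed.

Lemma in_span_S (B : nat -> R -> R) (n : nat) (p : R -> R) :
  in_span B n p -> in_span B (S n) p.
Proof. intros h; exists 0, p; split; [exact h|intros s; ring]. Qed.

Lemma in_span_monomial_mul (n : nat) (p : R -> R) :
  in_span monomial n p -> in_span monomial (S n) (fun s => s * p s).
Proof.
  revert p; induction n as [|n IH]; intros p.
  - intros h; exists 0, (fun s => s * p s); split; [|intros s; ring].
    intros s; rewrite h; ring.
  - intros (l & q & hq & h); exists l, (fun s => s * q s); split; [now apply IH|].
    intros s; rewrite h; unfold monomial; simpl; ring.
Qed.

Lemma in_span_monomial_sum (a : nat -> R) (n : nat) :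
  in_span monomial (S n) (fun s => sum_f_R0 (fun i => a i * s ^ i) n).
Proof.
  induction n as [|n IH].
  - exists (a 0%nat), (fun _ => 0); split; [easy|intros s; unfold monomial; simpl; ring].
  - exists (a (S n)), (fun s => sum_f_R0 (fun i => a i * s ^ i) n); split; [exact IH|].
    intros s; unfold monomial; simpl; ring.
Qed.

Lemma poly_leading_term (n : nat) (p : R -> R) : is_poly_of_degree n p ->
  exists l q, l <> 0 /\ in_span monomial n q /\ forall s, p s = l * s ^ n + q s.
Proof.
  intros (a & ha & hp).
  destruct n as [|n].
  - exists (a 0%nat), (fun _ => 0); repeat split; auto; intros s; rewrite hp; simpl; ring.
  - exists (a (S n)), (fun s => sum_f_R0 (fun i => a i * s ^ i) n); split; [exact ha|].
    split; [apply in_span_monomial_sum|]; intros s; rewrite hp; simpl; ring.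
Qed.

Lemma jac_leading_term (c d : R) (n : nat) : -1 < c -> -1 < d ->
  exists l q, l <> 0 /\ in_span monomial n q /\ forall s, jac c d n s = l * s ^ n + q s.
Proof.
  intros hc hd.
  induction n as [| |n (l0 & q0 & hl0 & hq0 & h0) (l1 & q1 & hl1 & hq1 & h1)] using nat_ind_step2.
  - exists 1, (fun _ => 0); repeat split; [lra|intros s; simpl; ring].
  - exists ((c + d + 2) / 2), (fun _ => c + 1 - (c + d + 2) / 2); split; [lra|].
    split; [|intros s; simpl; field].
    exists (c + 1 - (c + d + 2) / 2), (fun _ => 0); split; [easy|intros s; unfold monomial; simpl; ring].
  - set (a := recA c d (S n)); set (b := recB c d (S n)); set (e := recC c d (S n)).
    exists (a * l1), (fun s => 1 * (a * (s * q1 s) + - b * jac c d (S n) s) + - e * jac c d n s).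
    assert (hn := pos_INR n).
    split; [|split].
    + apply Rmult_integral_contrapositive; split; [|exact hl1].
      unfold a, recA; rewrite S_INR.
      apply Rgt_not_eq, Rdiv_lt_0_compat; apply Rmult_lt_0_compat; lra.
    + apply in_span_combine; [apply in_span_combine|].
      * now apply in_span_monomial_mul.
      * exists l1, q1; split; [exact hq1|exact h1].
      * apply in_span_S; exists l0, q0; split; [exact hq0|exact h0].
    + intros s; rewrite jac_SS; fold a b e; rewrite h1; simpl; ring.
Qed.

(** [jac n] has exact degree [n], so it can replace the [n]-th monomial. *)
Lemma in_span_jac (c d : R) (n : nat) (p : R -> R) : -1 < c -> -1 < d ->
  in_span monomial n p -> in_span (jac c d) n p.
Proof.
  intros hc hd; revert p; induction n as [|n IH]; intros p; [easy|].
  intros (l & q & hq & hp).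
  destruct (jac_leading_term c d n hc hd) as (k & r & hk & hr & hj).
  exists (l / k), (fun s => 1 * q s + - (l / k) * r s); split.
  - apply IH, in_span_combine; assumption.
  - intros s; rewrite hp, hj; unfold monomial; field; exact hk.
Qed.

Lemma null_integral_in_span (c d : R) (B : nat -> R -> R) (n : nat) (D F : R -> R) :
  null_integral c d (fun _ => 0) ->
  (forall i, (i < n)%nat -> null_integral c d (fun s => B i s * F s)) ->
  in_span B n D -> null_integral c d (fun s => D s * F s).
Proof.
  intros hz; revert D; induction n as [|n IH]; intros D hB hD.
  - revert hz; apply null_integral_ext; intros s _; rewrite (hD s); ring.
  - destruct hD as (l & q & hq & e).
    assert (h1 := hB n ltac:(lia)); assert (h2 := IH q ltac:(intros; apply hB; lia) hq).
    assert (h3 := null_integral_combine c d l 1 _ _ h1 h2).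
    revert h3; apply null_integral_ext; intros s _; rewrite e; ring.
Qed.

Lemma null_integral_0 (c d : R) : -1 < c -> -1 < d -> null_integral c d (fun _ => 0).
Proof.
  intros hc hd.
  assert (h := jac_orthogonal c d 0 1 hc hd ltac:(lia)).
  assert (h' := null_integral_combine c d 0 0 _ _ h h).
  revert h'; apply null_integral_ext; intros s _; ring.
Qed.

Lemma continuous_in_span (n : nat) (p : R -> R) (s : R) : in_span monomial n p -> continuous p s.
Proof.
  revert p; induction n as [|n IH]; intros p.
  - intros h; apply (continuous_ext (fun _ => 0)); [now intros t; rewrite (h t)|apply continuous_const].
  - intros (l & q & hq & h); apply (continuous_ext (fun t => l * t ^ n + q t)); [now intros t; rewrite (h t)|].
    apply (continuous_plus (fun t => l * t ^ n) q); [|now apply IH].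
    apply (ex_derive_continuous (fun t => l * t ^ n)); auto_derive; easy.
Qed.

(** By induction on [j].  Subtracting from [P j] the multiple of [jac j] with the same
leading coefficient leaves a polynomial [D] of lower degree, a combination of the
[jac i = P i] with [i < j], to which both [P j] and [jac j] are orthogonal.  Hence [D] is
orthogonal to itself and vanishes.  The multiple is 1 because the values at 1 agree. *)
Lemma jacobi_unique (c d : R) (P : nat -> R -> R) (j : nat) (s : R) :
  -1 < c -> -1 < d -> is_jacobi c d P -> -1 <= s <= 1 -> P j s = jac c d j s.
Proof.
  intros hc hd [hdeg horth hone]; revert s.
  induction j as [j IH] using (well_founded_induction lt_wf); intros s hs.
  destruct (poly_leading_term j (P j) (hdeg j)) as (k & r & hk & hr & hP).
  destruct (jac_leading_term c d j hc hd) as (l & q & hl & hq & hJ).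
  set (D := fun s => 1 * r s + - (k / l) * q s).
  assert (hD : in_span monomial j D) by now apply in_span_combine.
  assert (eD : forall s, P j s = k / l * jac c d j s + D s).
  { intros t; unfold D; rewrite hP, hJ; field; exact hl. }
  assert (hcont : forall s, continuous D s) by (intros t; now apply (continuous_in_span j)).
  assert (hDD : null_integral c d (fun s => D s * D s)).
  { apply (null_integral_in_span c d (jac c d) j); [now apply null_integral_0| |now apply in_span_jac].
    intros i hi.
    assert (o1 := horth i j ltac:(lia)); assert (o2 := jac_orthogonal c d i j hc hd ltac:(lia)).
    assert (o3 := null_integral_combine c d 1 (- (k / l)) _ _ o1 o2).
    revert o3; apply null_integral_ext; intros t ht.
    rewrite (IH i hi t ltac:(lra)), (eD t); ring. }
  assert (hD0 := null_integral_square c d D (fun s _ => hcont s) hDD).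
  assert (hD1 : D 1 = 0 /\ D (-1) = 0).
  { split; apply continuous_eq_0_of_limit; auto; intros e he.
    - exists (1 - Rmin e 1 / 2); assert (hm := Rmin_l e 1); assert (hm' := Rmin_r e 1).
      assert (hm0 := Rmin_pos e 1 he Rlt_0_1); split; [lra|apply hD0; lra].
    - exists (-1 + Rmin e 1 / 2); assert (hm := Rmin_l e 1); assert (hm' := Rmin_r e 1).
      assert (hm0 := Rmin_pos e 1 he Rlt_0_1); split; [lra|apply hD0; lra]. }
  assert (e1 := eD 1); rewrite hone, <- (jac_at_1 c d j hc hd) in e1.
  destruct hD1 as [hD1 hDm1]; rewrite hD1 in e1.
  assert (hJ1 := jac_at_1_pos c d j hc hd).
  assert (ekl : k / l = 1).
  { apply (Rmult_eq_reg_r (jac c d j 1)); lra. }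
  rewrite eD, ekl.
  assert (Ds : D s = 0).
  { destruct (Req_dec s 1) as [->|n1]; [exact hD1|].
    destruct (Req_dec s (-1)) as [->|n2]; [exact hDm1|apply hD0; lra]. }
  lra.
Qed.

(** * Integrals against the kernel and their derivatives *)

Definition kernel_int (f : R -> R) (p z : R) : R :=
  RInt (fun s => f s * Rpower (z - s) p) (-1) 1.

Lemma is_derive_kernel (p z s : R) : s < z ->
  is_derive (fun s => Rpower (z - s) p) s (- p * Rpower (z - s) (p - 1)).
Proof.
  intros hs; evar_last.
  - apply (is_derive_comp (fun t => Rpower t p) (fun s => z - s)).
    + apply is_derive_Rpower; lra.
    + instantiate (1 := -1); auto_derive; [easy|ring].
  - unfold scal; simpl; unfold mult; simpl; ring.
Qed.

Lemma continuous_kernel (p z s : R) : s < z -> continuous (fun s => Rpower (z - s) p) s.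
Proof.
  intros hs; apply (ex_derive_continuous (fun s => Rpower (z - s) p)); eexists.
  now apply is_derive_kernel.
Qed.

Lemma ex_RInt_kernel (f : R -> R) (p z : R) : 1 < z -> (forall s, continuous f s) ->
  ex_RInt (fun s => f s * Rpower (z - s) p) (-1) 1.
Proof.
  intros hz hf; apply (ex_RInt_continuous (V := R_CompleteNormedModule)).
  rewrite Rmin_left, Rmax_right by lra; intros s hs.
  apply (continuous_mult f (fun s => Rpower (z - s) p)); [apply hf|apply continuous_kernel; lra].
Qed.

Lemma RInt_combine3 (f g h : R -> R) (a b e u v : R) :
  ex_RInt f u v -> ex_RInt g u v -> ex_RInt h u v ->
  RInt (fun s => a * f s + b * g s + e * h s) u v = a * RInt f u v + b * RInt g u v + e * RInt h u v.
Proof.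
  intros hf hg hh; apply is_RInt_unique.
  apply (is_RInt_plus (V := R_NormedModule) (fun s => a * f s + b * g s) (fun s => e * h s)).
  - apply (is_RInt_plus (V := R_NormedModule) (fun s => a * f s) (fun s => b * g s));
      apply (is_RInt_scal (V := R_NormedModule)), (RInt_correct (V := R_CompleteNormedModule)); assumption.
  - apply (is_RInt_scal (V := R_NormedModule)), (RInt_correct (V := R_CompleteNormedModule)); assumption.
Qed.

(** The [s]-derivative of [(z - s)^p] is [- p (z - s)^(p - 1)], so passing to an
antiderivative of the other factor lowers the exponent of the kernel by one. *)
Lemma kernel_int_by_parts (F f : R -> R) (p z : R) : 1 < z ->
  (forall s, is_derive F s (f s)) -> (forall s, continuous f s) ->
  kernel_int f p z =
    F 1 * Rpower (z - 1) p - F (-1) * Rpower (z + 1) p + p * kernel_int F (p - 1) z.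
Proof.
  intros hz hF hf; unfold kernel_int.
  assert (hFc : forall s, continuous F s).
  { intros s; apply (ex_derive_continuous F); eexists; apply hF. }
  assert (i1 := ex_RInt_kernel f p z hz hf); assert (i2 := ex_RInt_kernel F (p - 1) z hz hFc).
  (* The last summand has coefficient 0; it gives the integrand the form of
     [RInt_combine3]. *)
  assert (h : is_RInt (fun s => 1 * (f s * Rpower (z - s) p) + - p * (F s * Rpower (z - s) (p - 1))
                + 0 * (f s * Rpower (z - s) p)) (-1) 1
               (minus (F 1 * Rpower (z - 1) p) (F (-1) * Rpower (z - -1) p))).
  { apply (is_RInt_derive (V := R_CompleteNormedModule) (fun s => F s * Rpower (z - s) p));
      rewrite Rmin_left, Rmax_right by lra; intros s hs.
    - evar_last.
      + apply (is_derive_mult F (fun s => Rpower (z - s) p));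
          [apply hF|apply is_derive_kernel; lra|intros; apply Rmult_comm].
      + unfold plus, mult; simpl; ring.
    - apply (continuous_plus (fun s => 1 * (f s * Rpower (z - s) p) + - p * (F s * Rpower (z - s) (p - 1)))
          (fun s => 0 * (f s * Rpower (z - s) p))).
      + apply (continuous_plus (fun s => 1 * (f s * Rpower (z - s) p)) (fun s => - p * (F s * Rpower (z - s) (p - 1)))).
        * apply (continuous_scal_r 1 (fun s => f s * Rpower (z - s) p)).
          apply (continuous_mult f (fun s => Rpower (z - s) p)); [apply hf|apply continuous_kernel; lra].
        * apply (continuous_scal_r (- p) (fun s => F s * Rpower (z - s) (p - 1))).
          apply (continuous_mult F (fun s => Rpower (z - s) (p - 1))); [apply hFc|apply continuous_kernel; lra].
      + apply (continuous_scal_r 0 (fun s => f s * Rpower (z - s) p)).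
        apply (continuous_mult f (fun s => Rpower (z - s) p)); [apply hf|apply continuous_kernel; lra]. }
  apply (is_RInt_unique (V := R_CompleteNormedModule)) in h.
  rewrite RInt_combine3 in h by assumption.
  unfold minus, plus, opp in h; simpl in h.
  replace (z - -1) with (z + 1) in h by ring. lra.
Qed.

(** Integration by parts with the derivative 0 of the constant 1. *)
Lemma kernel_int_1 (p z : R) : 1 < z -> p <> 0 ->
  kernel_int (fun _ => 1) (p - 1) z = (Rpower (z + 1) p - Rpower (z - 1) p) / p.
Proof.
  intros hz hp.
  assert (h := kernel_int_by_parts (fun _ => 1) (fun _ => 0) p z hz
    (fun s => is_derive_const 1 s) (fun s => continuous_const 0 s)).
  assert (h0 : kernel_int (fun _ => 0) p z = 0).
  { unfold kernel_int; rewrite (RInt_ext _ (fun _ => 0)); [|intros; apply Rminus_diag_uniq; ring].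
    rewrite RInt_const; unfold scal; simpl; unfold mult; simpl; ring. }
  rewrite h0 in h; apply (Rmult_eq_reg_l p); [|exact hp].
  transitivity (Rpower (z + 1) p - Rpower (z - 1) p); [lra|field; exact hp].
Qed.

Lemma kernel_int_jac_0 (c d mu z : R) : 1 < z -> 0 < mu ->
  kernel_int (jac c d 0) (mu - 1) z = (Rpower (z + 1) mu - Rpower (z - 1) mu) / mu.
Proof. intros hz hmu; apply (kernel_int_1 mu z hz); lra. Qed.

Lemma kernel_int_jac_1 (c d mu z : R) : 1 < z -> 0 < mu ->
  kernel_int (jac c d 1) (mu - 1) z =
    (jac c d 1 (-1) * Rpower (z + 1) mu - jac c d 1 1 * Rpower (z - 1) mu) / mu
    + (c + d + 2) / 2 * (Rpower (z + 1) (mu + 1) - Rpower (z - 1) (mu + 1)) / (mu * (mu + 1)).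
Proof.
  intros hz hmu.
  assert (h := kernel_int_by_parts (jac c d 1) (jac' c d 1) mu z hz
                 (is_derive_jac c d 1) (continuous_jac' c d 1)).
  assert (h1 := kernel_int_1 (mu + 1) z hz ltac:(lra)).
  replace (mu + 1 - 1) with mu in h1 by ring.
  assert (h2 : kernel_int (jac' c d 1) mu z = (c + d + 2) / 2 * kernel_int (fun _ => 1) mu z).
  { unfold kernel_int; rewrite <- (RInt_scal (V := R_CompleteNormedModule)).
    - apply RInt_ext; intros s _; unfold scal; simpl; unfold mult; simpl; field.
    - apply (ex_RInt_kernel (fun _ => 1) mu z hz (continuous_const 1)). }
  rewrite h1 in h2; rewrite h2 in h.
  apply (Rmult_eq_reg_l mu); [|lra].
  replace (mu * kernel_int (jac c d 1) (mu - 1) z) with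
    ((c + d + 2) / 2 * ((Rpower (z + 1) (mu + 1) - Rpower (z - 1) (mu + 1)) / (mu + 1))
     - (jac c d 1 1 * Rpower (z - 1) mu - jac c d 1 (-1) * Rpower (z + 1) mu)) by lra.
  field; lra.
Qed.

Lemma tildeDen_pos (c d mu : R) (j : nat) : -1 < c -> -1 < d -> 0 < mu -> (1 <= j)%nat ->
  0 < tildeDen c d mu j.
Proof.
  intros hc hd hmu hj; unfold tildeDen.
  assert (hx : 1 <= INR j) by (apply (le_INR 1); exact hj).
  assert (h1 : 0 < recA c d j).
  { unfold recA; apply Rdiv_lt_0_compat; repeat apply Rmult_lt_0_compat; lra. }
  assert (h2 : 0 < hatC c d j).
  { unfold hatC; apply Rdiv_lt_0_compat; repeat apply Rmult_lt_0_compat; lra. }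
  assert (h3 := Rmult_lt_0_compat _ _ (Rmult_lt_0_compat _ _ hmu h1) h2).
  lra.
Qed.

(** The core of the theorem.  In the three-term recurrence [s = z - (z - s)] splits off an
integral with exponent [mu], which integration by parts with the antiderivative [hatSum]
of [jac j] brings back to exponent [mu - 1].  The integral at [j + 1] then occurs on both
sides, with total coefficient [tildeDen]. *)
Lemma kernel_int_jac_recurrence (c d mu z : R) (j : nat) :
  -1 < c -> -1 < d -> 0 < mu -> 1 < z -> (1 <= j)%nat ->
  kernel_int (jac c d (j + 1)) (mu - 1) z =
    (tildeA c d mu j * z - tildeB c d mu j) * kernel_int (jac c d j) (mu - 1) z
    - tildeC c d mu j * kernel_int (jac c d (j - 1)) (mu - 1) z
    + (tildeD c d (jac c d) mu j * Rpower (z + 1) mu - tildeE c d (jac c d) mu j * Rpower (z - 1) mu).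
Proof.
  intros hc hd hmu hz hj.
  assert (hden := tildeDen_pos c d mu j hc hd hmu hj).
  assert (hex : forall n p, ex_RInt (fun s => jac c d n s * Rpower (z - s) p) (-1) 1).
  { intros n p; apply ex_RInt_kernel; [exact hz|apply continuous_jac]. }
  assert (hrec : kernel_int (jac c d (j + 1)) (mu - 1) z =
    (recA c d j * z - recB c d j) * kernel_int (jac c d j) (mu - 1) z
    + - recC c d j * kernel_int (jac c d (j - 1)) (mu - 1) z
    + - recA c d j * kernel_int (jac c d j) mu z).
  { unfold kernel_int; rewrite <- RInt_combine3 by apply hex.
    apply RInt_ext; rewrite Rmin_left, Rmax_right by lra; intros s hs.
    destruct j as [|n]; [lia|]; replace (S n - 1)%nat with n by lia; rewrite Nat.add_1_r, jac_SS.
    replace mu with (mu - 1 + 1) at 4 by ring; rewrite Rpower_plus_1 by lra; apply Rminus_diag_uniq; ring. }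
  assert (hparts := kernel_int_by_parts (hatSum c d (jac c d) j) (jac c d j) mu z hz
    (fun s => is_derive_hatSum c d j s hc hd hj) (continuous_jac c d j)).
  assert (hQ : kernel_int (hatSum c d (jac c d) j) (mu - 1) z =
    hatA c d j * kernel_int (jac c d (j - 1)) (mu - 1) z + hatB c d j * kernel_int (jac c d j) (mu - 1) z
    + hatC c d j * kernel_int (jac c d (j + 1)) (mu - 1) z).
  { unfold kernel_int; rewrite <- RInt_combine3 by apply hex.
    apply RInt_ext; intros s _; unfold hatSum; apply Rminus_diag_uniq; ring. }
  rewrite hQ in hparts; rewrite hparts in hrec.
  unfold tildeA, tildeB, tildeC, tildeD, tildeE.
  apply (Rmult_eq_reg_l (tildeDen c d mu j)); [|lra].
  transitivity (kernel_int (jac c d (j + 1)) (mu - 1) z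
    + mu * recA c d j * hatC c d j * kernel_int (jac c d (j + 1)) (mu - 1) z); [unfold tildeDen; ring|].
  rewrite hrec at 1; field; lra.
Qed.

(** Only the values of [P j] on [[-1, 1]] enter. *)
Lemma breveR_jacobi (k : nat) (c d beta : R) (P : nat -> R -> R) (j : nat) (z : R) :
  -1 < c -> -1 < d -> is_jacobi c d P ->
  breveR k P beta j z = / Gamma (INR k - beta) * kernel_int (jac c d j) (INR k - beta - 1) z.
Proof.
  intros hc hd hP; unfold breveR, kernel_int; f_equal.
  apply RInt_ext; rewrite Rmin_left, Rmax_right by lra; intros s hs.
  rewrite (jacobi_unique c d P j s hc hd hP) by lra.
  unfold Rdiv; rewrite <- Rpower_Ropp; do 2 f_equal; ring.
Qed.

(** The coefficient [p (p - 1) ... (p - n + 1)] of the [n]-th derivative of a power with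
exponent [p]. *)
Fixpoint falling (p : R) (n : nat) : R :=
  match n with
  | O => 1
  | S n' => falling p n' * (p - INR n')
  end.

(** The exponents [p] that are [0, ..., n - 1] are excluded since there the product is 0
while [Gamma (p + 1)] is not. *)
Lemma Gamma_falling (p : R) (n : nat) : (forall i, (i < n)%nat -> p <> INR i) ->
  Gamma (p + 1) = falling p n * Gamma (p + 1 - INR n).
Proof.
  induction n as [|n IH]; intros h.
  - simpl; rewrite Rminus_0_r; ring.
  - rewrite IH by (intros; apply h; lia).
    assert (hn : p - INR n <> 0) by (assert (h0 := h n ltac:(lia)); lra).
    replace (p + 1 - INR n) with (p - INR n + 1) by ring; rewrite Gamma_plus_1 by exact hn.
    rewrite S_INR; replace (p + 1 - (INR n + 1)) with (p - INR n) by ring; simpl; ring.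
Qed.

Lemma falling_div_Gamma (p : R) (n : nat) : 0 < p -> (forall i : nat, p <> INR i) ->
  falling p n / Gamma (p + 1) = / Gamma (p + 1 - INR n).
Proof.
  intros hp hi.
  assert (h := Gamma_falling p n (fun i _ => hi i)); assert (hg := Gamma_pos (p + 1) ltac:(lra)).
  rewrite h in hg |- *.
  assert (h1 : falling p n <> 0) by (intros e; rewrite e in hg; lra).
  assert (h2 : Gamma (p + 1 - INR n) <> 0) by (intros e; rewrite e in hg; lra).
  field; auto.
Qed.

Lemma not_INR_of_between (p : R) (a : nat) (i : nat) : INR a < p < INR a + 1 -> p <> INR i.
Proof.
  intros [h1 h2] ->; rewrite <- S_INR in h2; apply INR_lt in h1, h2; lia.
Qed.

Lemma is_derive_falling_power (a p z : R) (n : nat) : 0 < z + a ->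
  is_derive (fun z => falling p n * Rpower (z + a) (p - INR n)) z
    (falling p (S n) * Rpower (z + a) (p - INR (S n))).
Proof.
  intros hz; evar_last.
  - apply is_derive_scal, (is_derive_comp (fun t => Rpower t (p - INR n)) (fun z => z + a)).
    + now apply is_derive_Rpower.
    + instantiate (1 := 1); auto_derive; [easy|ring].
  - rewrite S_INR; replace (p - (INR n + 1)) with (p - INR n - 1) by ring.
    unfold scal; simpl; unfold mult; simpl; ring.
Qed.

Lemma locally_gt_1 (z : R) (Q : R -> Prop) : 1 < z -> (forall t, 1 < t -> Q t) -> locally z Q.
Proof.
  intros hz hQ; assert (he : 0 < z - 1) by lra; exists (mkposreal _ he); intros t ht.
  apply ball_R in ht; simpl in ht; apply hQ; lra.
Qed.

(** All higher derivatives are computed by exhibiting candidates that differentiate into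
one another. *)
Lemma Derive_n_of_family (f : R -> R) (g : nat -> R -> R) :
  (forall z, 1 < z -> f z = g 0%nat z) ->
  (forall n z, 1 < z -> is_derive (g n) z (g (S n) z)) ->
  forall n z, 1 < z -> ex_derive_n f n z /\ Derive_n f n z = g n z.
Proof.
  intros h0 hS.
  assert (hD : forall n z, 1 < z -> Derive_n f n z = g n z).
  { induction n as [|n IH]; intros z hz; [now apply h0|].
    simpl; rewrite (Derive_ext_loc _ (g n)); [apply is_derive_unique, hS, hz|].
    now apply locally_gt_1. }
  intros n z hz; split; [|now apply hD].
  destruct n as [|n]; [easy|]; simpl.
  apply (ex_derive_ext_loc (g n)); [|eexists; apply hS, hz].
  apply locally_gt_1; [exact hz|]; intros t ht; symmetry; now apply hD.
Qed.

(** Leibniz' rule for the factor [a * z - b], whose second derivative is 0.  For [n = 0] the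
index [n - 1] is truncated to 0, but the term has the factor [INR 0]. *)
Lemma Derive_n_recurrence (f0 f1 f2 : R -> R) (a b e u v p : R) :
  (forall n z, 1 < z -> ex_derive_n f0 n z) -> (forall n z, 1 < z -> ex_derive_n f1 n z) ->
  (forall z, 1 < z ->
    f2 z = (a * z - b) * f1 z - e * f0 z + (u * Rpower (z + 1) p - v * Rpower (z - 1) p)) ->
  forall n z, 1 < z -> ex_derive_n f2 n z /\
    Derive_n f2 n z = (a * z - b) * Derive_n f1 n z - e * Derive_n f0 n z
      + INR n * a * Derive_n f1 (n - 1) z
      + falling p n * (u * Rpower (z + 1) (p - INR n) - v * Rpower (z - 1) (p - INR n)).
Proof.
  intros h0 h1 h2.
  apply (Derive_n_of_family f2 (fun n z => (a * z - b) * Derive_n f1 n z - e * Derive_n f0 n z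
      + INR n * a * Derive_n f1 (n - 1) z
      + falling p n * (u * Rpower (z + 1) (p - INR n) - v * Rpower (z - 1) (p - INR n)))).
  - intros z hz; rewrite h2 by exact hz; simpl; rewrite !Rminus_0_r; ring.
  - intros n z hz.
    assert (d0 : is_derive (Derive_n f0 n) z (Derive_n f0 (S n) z)) by (apply Derive_correct, (h0 (S n)), hz).
    assert (d1 : is_derive (Derive_n f1 n) z (Derive_n f1 (S n) z)) by (apply Derive_correct, (h1 (S n)), hz).
    assert (d2 : is_derive (fun z => INR n * a * Derive_n f1 (n - 1) z) z (INR n * a * Derive_n f1 n z)).
    (* For [n = 0] both sides are 0, whatever the truncated index stands for. *)
    { destruct n as [|n].
      - simpl; evar_last; [apply (is_derive_ext (fun _ => 0)); [intros t; simpl; apply Rminus_diag_uniq; ring|apply is_derive_const]|].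
        unfold zero; simpl; ring.
      - replace (S n - 1)%nat with n by lia; apply is_derive_scal, Derive_correct, (h1 (S n)), hz. }
    assert (p1 := is_derive_falling_power 1 p z n ltac:(lra)).
    assert (p2 := is_derive_falling_power (-1) p z n ltac:(lra)).
    apply (is_derive_ext (fun z => ((a * z - b) * Derive_n f1 n z - e * Derive_n f0 n z)
      + INR n * a * Derive_n f1 (n - 1) z
      + (u * (falling p n * Rpower (z + 1) (p - INR n)) - v * (falling p n * Rpower (z + -1) (p - INR n))))).
    { intros t; change (t - 1) with (t + -1); apply Rminus_diag_uniq; ring. }
    evar_last.
    + apply (is_derive_plus (fun z => ((a * z - b) * Derive_n f1 n z - e * Derive_n f0 n z)
        + INR n * a * Derive_n f1 (n - 1) z)).
      * apply (is_derive_plus (fun z => (a * z - b) * Derive_n f1 n z - e * Derive_n f0 n z)); [|exact d2].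
        exact (is_derive_three_term a b e _ _ _ _ _ d1 d0).
      * apply (is_derive_minus (fun z => u * (falling p n * Rpower (z + 1) (p - INR n)))
          (fun z => v * (falling p n * Rpower (z + -1) (p - INR n)))).
        -- apply is_derive_scal, p1.
        -- apply is_derive_scal, p2.
    + unfold minus, plus, opp; cbn [AbelianMonoid.plus]. simpl.
      change (z - 1) with (z + -1); rewrite Nat.sub_0_r.
      destruct n; simpl; ring.
Qed.

(** * The recurrence for the derivatives *)

Lemma breveR_recurrence (k : nat) (c d beta : R) (P : nat -> R -> R) (j : nat) (z : R) :
  -1 < c -> -1 < d -> is_jacobi c d P -> beta < INR k -> 1 < z -> (1 <= j)%nat ->
  let mu := INR k - beta in
  breveR k P beta (j + 1) z =
    (tildeA c d mu j * z - tildeB c d mu j) * breveR k P beta j z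
    - tildeC c d mu j * breveR k P beta (j - 1) z
    + (tildeD c d P mu j / Gamma mu * Rpower (z + 1) mu
       - tildeE c d P mu j / Gamma mu * Rpower (z - 1) mu).
Proof.
  intros hc hd hP hb hz hj mu.
  assert (hmu : 0 < mu) by (unfold mu; lra).
  rewrite !(breveR_jacobi k c d beta P) by assumption; fold mu.
  rewrite (kernel_int_jac_recurrence c d mu z j) by assumption.
  replace (tildeD c d P mu j) with (tildeD c d (jac c d) mu j).
  2:{ unfold tildeD, hatSum; rewrite !(jacobi_unique c d P) by (assumption || lra); reflexivity. }
  replace (tildeE c d P mu j) with (tildeE c d (jac c d) mu j).
  2:{ unfold tildeE, hatSum; rewrite !(jacobi_unique c d P) by (assumption || lra); reflexivity. }
  field; apply Rgt_not_eq, Gamma_pos, hmu.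
Qed.

Lemma Derive_n_breveR_0 (k : nat) (c d beta : R) (P : nat -> R -> R) :
  -1 < c -> -1 < d -> is_jacobi c d P -> INR k - 1 < beta < INR k ->
  let mu := INR k - beta in
  forall n z, 1 < z -> ex_derive_n (breveR k P beta 0) n z /\
    Derive_n (breveR k P beta 0) n z =
      (Rpower (z + 1) (mu - INR n) - Rpower (z - 1) (mu - INR n)) / Gamma (mu + 1 - INR n).
Proof.
  intros hc hd hP hb mu n z hz.
  assert (hmu : 0 < mu < 1) by (unfold mu; lra).
  assert (hni : forall i, mu <> INR i) by (intros i; apply (not_INR_of_between mu 0); simpl; lra).
  assert (hg := Gamma_pos (mu + 1) ltac:(lra)).
  destruct (Derive_n_of_family (breveR k P beta 0) (fun n z =>
      / Gamma (mu + 1) * (falling mu n * Rpower (z + 1) (mu - INR n)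
                          - falling mu n * Rpower (z - 1) (mu - INR n)))) with (n := n) (z := z)
    as [h1 h2]; [| |exact hz|].
  - intros t ht; rewrite (breveR_jacobi k c d) by assumption; fold mu.
    rewrite kernel_int_jac_0, Gamma_plus_1 by lra.
    assert (h := Gamma_pos mu ltac:(lra)).
    simpl; rewrite Rminus_0_r; field; lra.
  - intros i t ht; apply is_derive_scal, (is_derive_minus
      (fun z => falling mu i * Rpower (z + 1) (mu - INR i)) (fun z => falling mu i * Rpower (z - 1) (mu - INR i))).
    + apply (is_derive_falling_power 1); lra.
    + apply (is_derive_falling_power (-1)); lra.
  - split; [exact h1|]; rewrite h2.
    unfold Rdiv; rewrite <- (falling_div_Gamma mu n) by (lra || assumption).
    field; lra.
Qed.

Lemma Derive_n_breveR_1 (k : nat) (c d beta : R) (P : nat -> R -> R) :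
  -1 < c -> -1 < d -> is_jacobi c d P -> INR k - 1 < beta < INR k ->
  let mu := INR k - beta in
  forall n z, 1 < z -> ex_derive_n (breveR k P beta 1) n z /\
    Derive_n (breveR k P beta 1) n z =
      (P 1%nat (-1) * Rpower (z + 1) (mu - INR n) - P 1%nat 1 * Rpower (z - 1) (mu - INR n))
        / Gamma (mu + 1 - INR n)
      + (c + d + 2) * (Rpower (z + 1) (mu + 1 - INR n) - Rpower (z - 1) (mu + 1 - INR n))
        / (2 * Gamma (mu + 2 - INR n)).
Proof.
  intros hc hd hP hb mu n z hz.
  assert (hmu : 0 < mu < 1) by (unfold mu; lra).
  assert (hni : forall i, mu <> INR i) by (intros i; apply (not_INR_of_between mu 0); simpl; lra).
  assert (hni' : forall i, mu + 1 <> INR i) by (intros i; apply (not_INR_of_between (mu + 1) 1); simpl; lra).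
  assert (hg := Gamma_pos (mu + 1) ltac:(lra)).
  assert (hg' := Gamma_pos (mu + 1 + 1) ltac:(lra)).
  rewrite !(jacobi_unique c d P) by (assumption || lra).
  set (u := jac c d 1 (-1)); set (v := jac c d 1 1).
  destruct (Derive_n_of_family (breveR k P beta 1) (fun n z =>
      / Gamma (mu + 1) * (u * (falling mu n * Rpower (z + 1) (mu - INR n))
                          - v * (falling mu n * Rpower (z - 1) (mu - INR n)))
      + (c + d + 2) / 2 / Gamma (mu + 1 + 1)
        * (falling (mu + 1) n * Rpower (z + 1) (mu + 1 - INR n)
           - falling (mu + 1) n * Rpower (z - 1) (mu + 1 - INR n)))) with (n := n) (z := z)
    as [h1 h2]; [| |exact hz|].
  - intros t ht; rewrite (breveR_jacobi k c d) by assumption; fold mu.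
    rewrite kernel_int_jac_1, (Gamma_plus_1 (mu + 1)), Gamma_plus_1 by lra; fold u v.
    assert (h := Gamma_pos mu ltac:(lra)).
    simpl; rewrite !Rminus_0_r; field; lra.
  - intros i t ht; apply (is_derive_plus (fun z => / Gamma (mu + 1) * (u * (falling mu i * Rpower (z + 1) (mu - INR i))
                          - v * (falling mu i * Rpower (z - 1) (mu - INR i)))));
      apply is_derive_scal.
    + apply (is_derive_minus
      (fun z => u * (falling mu i * Rpower (z + 1) (mu - INR i)))
      (fun z => v * (falling mu i * Rpower (z - 1) (mu - INR i)))); apply is_derive_scal.
      * apply (is_derive_falling_power 1); lra.
      * apply (is_derive_falling_power (-1)); lra.
    + apply (is_derive_minus
      (fun z => falling (mu + 1) i * Rpower (z + 1) (mu + 1 - INR i))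
      (fun z => falling (mu + 1) i * Rpower (z - 1) (mu + 1 - INR i))).
      * apply (is_derive_falling_power 1); lra.
      * apply (is_derive_falling_power (-1)); lra.
  - split; [exact h1|]; rewrite h2.
    replace (mu + 2 - INR n) with (mu + 1 + 1 - INR n) by ring.
    unfold Rdiv; rewrite Rinv_mult.
    rewrite <- (falling_div_Gamma mu n), <- (falling_div_Gamma (mu + 1) n) by (lra || assumption).
    field; lra.
Qed.

Lemma Derive_n_breveR_recurrence (k : nat) (c d beta : R) (P : nat -> R -> R) (j : nat) :
  -1 < c -> -1 < d -> is_jacobi c d P -> INR k - 1 < beta < INR k -> (1 <= j)%nat ->
  (forall n z, 1 < z -> ex_derive_n (breveR k P beta (j - 1)) n z) ->
  (forall n z, 1 < z -> ex_derive_n (breveR k P beta j) n z) ->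
  let mu := INR k - beta in
  forall n z, 1 < z -> ex_derive_n (breveR k P beta (j + 1)) n z /\
    Derive_n (breveR k P beta (j + 1)) n z =
      (tildeA c d mu j * z - tildeB c d mu j) * Derive_n (breveR k P beta j) n z
      - tildeC c d mu j * Derive_n (breveR k P beta (j - 1)) n z
      + INR n * tildeA c d mu j * Derive_n (breveR k P beta j) (n - 1) z
      + (tildeD c d P mu j * Rpower (z + 1) (mu - INR n)
         - tildeE c d P mu j * Rpower (z - 1) (mu - INR n))
        / (/ mu * Gamma (mu + 1 - INR n)).
Proof.
  intros hc hd hP hb hj h0 h1 mu n z hz.
  assert (hmu : 0 < mu < 1) by (unfold mu; lra).
  assert (hni : forall i, mu <> INR i) by (intros i; apply (not_INR_of_between mu 0); simpl; lra).
  assert (hrec := fun t ht => breveR_recurrence k c d beta P j t hc hd hP (proj2 hb) ht hj).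
  destruct (Derive_n_recurrence _ _ _ _ _ _ _ _ _ h0 h1 hrec n z hz) as [h2 h3].
  split; [exact h2|]; rewrite h3; fold mu; f_equal.
  assert (hg := Gamma_pos mu ltac:(lra)).
  unfold Rdiv; rewrite !Rinv_mult, Rinv_inv, <- (falling_div_Gamma mu n) by (lra || assumption).
  rewrite Gamma_plus_1 by lra; field; lra.
Qed.

Theorem theorem3p5 (k m : nat) (hm : (1 <= m <= k)%nat)
  (c d : R) (hc : -1 < c) (hd : -1 < d)
  (P : nat -> R -> R) (hP : is_jacobi c d P)
  (alpha : R -> R) (halpha : forall y, 1 < y -> INR k - 1 < alpha y < INR k)
  (y : R) (hy : 1 < y) :
  let mu := INR k - alpha y in
  let D := frozen_derive k P alpha in
  (forall (j n : nat) (z : R), 1 < z -> ex_derive_n (breveR k P (alpha y) j) n z)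
  /\
  D 0%nat m y =
    (Rpower (y + 1) (mu - INR m) - Rpower (y - 1) (mu - INR m))
    / Gamma (mu + 1 - INR m)
  /\
  D 1%nat m y =
    (P 1%nat (-1) * Rpower (y + 1) (mu - INR m)
     - P 1%nat 1 * Rpower (y - 1) (mu - INR m)) / Gamma (mu + 1 - INR m)
    + (c + d + 2) *
      (Rpower (y + 1) (mu + 1 - INR m) - Rpower (y - 1) (mu + 1 - INR m))
      / (2 * Gamma (mu + 2 - INR m))
  /\
  forall j : nat, (1 <= j)%nat ->
    D (j + 1)%nat m y =
      (tildeA c d mu j * y - tildeB c d mu j) * D j m y
      - tildeC c d mu j * D (j - 1)%nat m y
      + INR m * tildeA c d mu j * D j (m - 1)%nat y
      + (tildeD c d P mu j * Rpower (y + 1) (mu - INR m)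
         - tildeE c d P mu j * Rpower (y - 1) (mu - INR m))
        / (/ mu * Gamma (mu + 1 - INR m)).
Proof.
  intros mu D.
  assert (hb := halpha y hy).
  assert (hsmooth : forall j n z, 1 < z -> ex_derive_n (breveR k P (alpha y) j) n z).
  { induction j as [| |j IH0 IH1] using nat_ind_step2; intros n z hz.
    - now apply (Derive_n_breveR_0 k c d).
    - now apply (Derive_n_breveR_1 k c d).
    - rewrite <- Nat.add_1_r.
      apply (Derive_n_breveR_recurrence k c d); auto; [lia|].
      now replace (S j - 1)%nat with j by lia. }
  split; [exact hsmooth|split; [|split]].
  - exact (proj2 (Derive_n_breveR_0 k c d _ P hc hd hP hb m y hy)).
  - exact (proj2 (Derive_n_breveR_1 k c d _ P hc hd hP hb m y hy)).
  - intros j hj.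
    exact (proj2 (Derive_n_breveR_recurrence k c d _ P j hc hd hP hb hj (hsmooth _) (hsmooth _) m y hy)).
Qed.
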